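(* For all $n\ge0$ one has $$x(x-s)(x+t)\,\partial_{x} P_{n}(x) = \Theta^{+}_{n}(x) P_{n+1}(x) + \Omega_{n}(x) P_{n}(x) + \Theta^{-}_{n}(x) P_{n-1}(x),$$ where the spectral polynomials (with $\deg_x\Theta_n^\pm=2$, $\deg_x\Omega_n=3$) are \begin{multline*} \tfrac{S_{n+1}}{S_{n}}\Theta^{+}_{n}(x) = -(x-s)(x+t) - \xi s^{a+1}e^{-s}\tfrac{x+t}{\pi_{n}\eta_{n}}P_{n}(s)\Big[ \tfrac{S_{n}}{S_{n+1}}Q^{(1)}_{n+1}(-s)+(Y_{n,n}+s)Q^{(1)}_{n}(-s)-\tfrac{S_{n-1}}{S_{n}}Q^{(1)}_{n-1}(-s) \Big]\\ - \psi t^{b+1}e^{-t}\tfrac{x-s}{\pi_{n}\eta_{n}}P^{(1)}_{n}(-t)\Big[ \tfrac{S_{n}}{S_{n+1}}Q_{n+1}(t)+(Y_{n,n}-t)Q_{n}(t)-\tfrac{S_{n-1}}{S_{n}}Q_{n-1}(t) \Big], \end{multline*} \begin{multline*} \tfrac{S_{n}}{S_{n-1}}\Theta^{-}_{n}(x) = (x-s)(x+t) + \xi s^{a+1}e^{-s}\tfrac{x+t}{\pi_{n}\eta_{n}}P_{n}(s)\Big[ \tfrac{S_{n}}{S_{n+1}}Q^{(1)}_{n+1}(-s)-(X_{n,n}-s)Q^{(1)}_{n}(-s)-\tfrac{S_{n-1}}{S_{n}}Q^{(1)}_{n-1}(-s) \Big]\\ + \psi t^{b+1}e^{-t}\tfrac{x-s}{\pi_{n}\eta_{n}}P^{(1)}_{n}(-t)\Big[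 \tfrac{S_{n}}{S_{n+1}}Q_{n+1}(t)-(X_{n,n}+t)Q_{n}(t)-\tfrac{S_{n-1}}{S_{n}}Q_{n-1}(t) \Big] \end{multline*} (for $n=0$ the term $\Theta^-_nP_{n-1}$ is absent), and \begin{multline*} \Omega_{n}(x) = (x-s)(x+t)\left[ x+Y_{n,n}-n-a-b-1 \right]\\ - \xi s^{a+1}e^{-s}\tfrac{x+t}{\pi_{n}\eta_{n}}P_{n}(s)\Big[ \tfrac{S_{n}}{S_{n+1}}(X_{n,n}-x)Q^{(1)}_{n+1}(-s)+(Y_{n,n}+x)(X_{n,n}-s)Q^{(1)}_{n}(-s)+\tfrac{S_{n-1}}{S_{n}}(Y_{n,n}+x)Q^{(1)}_{n-1}(-s) \Big]\\ - \psi t^{b+1}e^{-t}\tfrac{x-s}{\pi_{n}\eta_{n}}P^{(1)}_{n}(-t)\Big[ \tfrac{S_{n}}{S_{n+1}}(X_{n,n}-x)Q_{n+1}(t)+(Y_{n,n}+x)(X_{n,n}+t)Q_{n}(t)+\tfrac{S_{n-1}}{S_{n}}(Y_{n,n}+x)Q_{n-1}(t) \Big]. \end{multline*}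
   Context: Fix $a,b,\xi,\psi\in\mathbb C$ with $\Re a,\Re b>-1$. For $s,t>0$ put $w_1(x)=(1-\xi\chi_{x>s})x^ae^{-x}$, $w_2(y)=(1-\psi\chi_{y>t})y^be^{-y}$ on $(0,\infty)$, $\langle f,g\rangle=\int_0^\infty\int_0^\infty\frac{w_1(x)w_2(y)}{x+y}f(x)g(y)\,dx\,dy$, $M_{j,k}=\langle x^j,y^k\rangle$, $Z_0=1$, $Z_n=\det(M_{j,k})_{0\le j,k\le n-1}$. $P_n,Q_n$ are polynomials of degree $n$ with the same leading coefficient $S_n$ ($S_n^2=Z_n/Z_{n+1}$) and $\langle P_m,Q_n\rangle=\delta_{m,n}$. $\pi_n=\int_0^\infty w_1P_n\,dx$, $\eta_n=\int_0^\infty w_2Q_n\,dy$, $X_{n,n}=\langle xP_n,Q_n\rangle$, $Y_{n,n}=\langle P_n,yQ_n\rangle$, $P^{(1)}_n(z)=\int_0^\infty\frac{w_1(x)}{z-x}P_n(x)\,dx$, $Q^{(1)}_n(z)=\int_0^\infty\frac{w_2(y)}{z-y}Q_n(y)\,dy$. Objects with index $-1$ are $0$. Standing generic conditions: all $M_{j,k}$ finite (absolutely convergent), $Z_n\ne0$, $\pi_n,\eta_n\neq0$ for all $n\ge0$. *)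

(* Defs.v *)
From HB Require Import structures.
From mathcomp Require Import all_boot all_order all_algebra.
From mathcomp Require Export complex.
From mathcomp Require Import all_classical all_reals all_analysis.

Set Implicit Arguments.
Unset Strict Implicit.
Unset Printing Implicit Defensive.

Import Order.TTheory GRing.Theory Num.Theory.
Import numFieldNormedType.Exports.

Local Open Scope classical_set_scope.
Local Open Scope ring_scope.
Local Open Scope complex_scope.

Section ComplexIntegral.
Context (d : measure_display) (T : measurableType d) (R : realType).
Variables (mu : {measure set T -> \bar R}) (D : set T).
Implicit Type f : T -> R[i].

(* Equivalent, for measurable f, to the integrability of |f|. *)
Definition cintegrable f : Prop :=
  mu.-integrable D (EFin \o (fun x => complex.Re (f x))) /\
  mu.-integrable D (EFin \o (fun x => complex.Im (f x))).

(* The value is only meaningful when cintegrable f holds. *)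
Definition cintegral f : R[i] :=
  (\int[mu]_(x in D) complex.Re (f x)) +i* (\int[mu]_(x in D) complex.Im (f x)).

End ComplexIntegral.

Section Cauchy.
Context (R : realType).
Implicit Types (f g w : R -> R[i]) (x y : R) (c z : R[i]) (p q : {poly R[i]}).

Definition halfline : set R := `]0, +oo[.

(* The principal value of x ^ c for x > 0 (junk for x <= 0). *)
Definition cpower x c : R[i] :=
  (expR (complex.Re c * ln x))%:C *
  (cos (complex.Im c * ln x) +i* sin (complex.Im c * ln x)).

Definition weight c (xi : R[i]) (s x : R) : R[i] :=
  (1 - xi * (s < x)%R%:R) * cpower x c * (expR (- x))%:C.

Definition evalR p : R -> R[i] := fun x => p.[x%:C].

Definition bracket_integrand w1 w2 f g (xy : R * R) : R[i] :=
  w1 xy.1 * w2 xy.2 / (xy.1 + xy.2)%:C * f xy.1 * g xy.2.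

Definition bracket_converges w1 w2 f g : Prop :=
  cintegrable (lebesgue_measure \x lebesgue_measure)%E
    (halfline `*` halfline) (bracket_integrand w1 w2 f g).

Definition bracket w1 w2 f g : R[i] :=
  cintegral (lebesgue_measure \x lebesgue_measure)%E
    (halfline `*` halfline) (bracket_integrand w1 w2 f g).

Definition bimoment w1 w2 (j k : nat) : R[i] :=
  bracket w1 w2 (fun x => x%:C ^+ j) (fun y => y%:C ^+ k).

Definition bimoment_det w1 w2 (n : nat) : R[i] :=
  \det (\matrix_(j < n, k < n) bimoment w1 w2 j k).

(* The sign of each S n is left free by S n ^+ 2 = Z_n / Z_{n+1}. *)
Definition cauchy_biorthonormal w1 w2
    (S : nat -> R[i]) (P Q : nat -> {poly R[i]}) : Prop :=
  [/\ forall n, S n ^+ 2 = bimoment_det w1 w2 n / bimoment_det w1 w2 n.+1,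
      forall n, size (P n) = n.+1 /\ lead_coef (P n) = S n,
      forall n, size (Q n) = n.+1 /\ lead_coef (Q n) = S n &
      forall m n, bracket w1 w2 (evalR (P m)) (evalR (Q n)) = (m == n)%:R].

Definition weighted_integral w p : R[i] :=
  cintegral lebesgue_measure halfline (fun x => w x * evalR p x).

Definition cauchy_transform w p z : R[i] :=
  cintegral lebesgue_measure halfline (fun x => w x / (z - x%:C) * evalR p x).

End Cauchy.

(* u_{n-1}, with the convention u_{-1} = 0. *)
Definition at_pred (V : nmodType) (u : nat -> V) (n : nat) : V :=
  if n is m.+1 then u m else 0.

(* Main.v *)
Require Import Defs.
From HB Require Import structures.
From mathcomp Require Import all_boot all_order all_algebra complex ring lra.
From mathcomp Require Import all_classical all_reals all_analysis measurable_realfun.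

(* The Cauchy kernel satisfies [x / (x + y) + y / (x + y) = 1], so that
   [<x f, g> + <f, y g>] factors as a product of two integrals; this gives the
   four-term recurrences and a Christoffel-Darboux formula for [sum_k L(Q_k) P_k],
   where [L] is either an evaluation or a Cauchy transform.  The kernel is also
   homogeneous of degree -1, and [x w'(x) = (c - x) w(x)] off the jump of [w];
   integrating by parts in each variable and adding therefore expresses
   [<x f', g> + <f, y g'>] through the bracket and the two jump contributions.
   Testing this against [Q_k] for [k < n] expands [x P_n'] in the basis [P_k], and
   the Christoffel-Darboux formula sums the expansion once it is multiplied by
   [(x - s) (x + t)].  The case [k = n] gives the value of [pi_n eta_n] that turns
   the result into the stated form of Omega. *)

Set Implicit Arguments.
Unset Strict Implicit.
Unset Printing Implicit Defensive.

Import Order.TTheory GRing.Theory Num.Theory.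
Import numFieldNormedType.Exports.

Local Open Scope classical_set_scope.
Local Open Scope ring_scope.
Local Open Scope complex_scope.

(** * Linear functionals and biorthonormal polynomials *)

(** The polynomial part works over any field, with abstract functionals for the integrals. Analysis
    enters through linearity, the rank-one relation, the action of ['X] on a Cauchy transform and
    the Euler relation; the rank-one and Euler relations are checked on monomials, as identities
    between bimoments. Origin of the denominators: let E be the sum of [mu2 (Q k) *: P k] over
    [k < n], and D its coefficient in the Christoffel-Darboux formula. The recurrence of [P n]
    yields only [mu1 (P n)] times E, that of [Q n] only [mu2 (Q n)] times D, so the product of D and
    E costs a division by each. Origin of [a + b + 1]: it is (a + 1) + (b + 1) - 1. Differentiating
    x w instead of w gives the exponents plus one, and a boundary value 0 at the origin because Re
    a, Re b > -1; differentiating the kernel in the two variables removes the fractions x / (x + y)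
    and y / (x + y), whose sum is 1. These fractions are at most 1, so convergence of the bimoments
    controls every double integral. Parts are then taken in one variable with the other fixed, where
    the kernel is bounded. *)

Section PolyFunctionals.
Variable F : fieldType.
Implicit Types (p q : {poly F}) (f g : {poly F} -> F) (P : nat -> {poly F}).

Lemma scalarf0 f : scalar f -> f 0 = 0.
Proof. by move=> /(_ (-1) 0 0); rewrite scaler0 addr0 mulN1r addNr. Qed.

Lemma scalarfZ f c p : scalar f -> f (c *: p) = c * f p.
Proof. by move=> lf; rewrite -[c *: p]addr0 lf scalarf0 // addr0. Qed.

Lemma scalarfD f p q : scalar f -> f (p + q) = f p + f q.
Proof. by move=> lf; rewrite -[p]scale1r lf scale1r mul1r. Qed.

Lemma scalarf_sum f n (c : nat -> F) P : scalar f ->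
  f (\sum_(k < n) c k *: P k) = \sum_(k < n) c k * f (P k).
Proof.
move=> lf; elim: n => [|n IHn]; first by rewrite !big_ord0 scalarf0.
by rewrite !big_ord_recr /= scalarfD // IHn scalarfZ.
Qed.

Lemma scalarf_ext f g : scalar f -> scalar g ->
  (forall n, f 'X^n = g 'X^n) -> f =1 g.
Proof.
move=> lf lg fgX p; rewrite -[p]coefK poly_def !scalarf_sum //.
by apply: eq_bigr => i _; rewrite fgX.
Qed.

(** Triangular elimination: subtracting the multiple of [P n] that cancels the coefficient of degree
    [n] lowers the size bound by one. *)
Lemma graded_basis P n p : (forall k, size (P k) = k.+1) -> (size p <= n)%N ->
  exists c : nat -> F, p = \sum_(k < n) c k *: P k.
Proof.
move=> sP; elim: n p => [|n IHn] p sp.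
  exists (fun=> 0); rewrite big_ord0; apply/eqP.
  by rewrite -size_poly_eq0 -leqn0.
have Pn0 : (P n)`_n != 0.
  by have := lead_coef_eq0 (P n); rewrite lead_coefE -size_poly_eq0 sP /= => ->.
have /IHn[c pE] : (size (p - (p`_n / (P n)`_n) *: P n)%R <= n)%N.
  apply/leq_sizeP => j; rewrite leq_eqVlt coefB coefZ => /predU1P[<-|nj].
    by rewrite divfK // subrr.
  by rewrite (nth_default _ (leq_trans sp nj)) [(P n)`_j]nth_default ?sP // mulr0 subr0.
exists (fun k => if k == n then p`_n / (P n)`_n else c k).
rewrite big_ord_recr /= eqxx -[LHS](subrK ((p`_n / (P n)`_n) *: P n)) pE.
by congr (_ + _); apply: eq_bigr => i _; rewrite ltn_eqF.
Qed.

End PolyFunctionals.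

Section Biorthonormal.
Variables (F : fieldType) (br : {poly F} -> {poly F} -> F).
Variables (S : nat -> F) (P Q : nat -> {poly F}).

Implicit Types p q : {poly F}.

Definition biorthonormal : Prop :=
  [/\ forall n, size (P n) = n.+1 /\ lead_coef (P n) = S n,
      forall n, size (Q n) = n.+1 /\ lead_coef (Q n) = S n &
      forall m n, br (P m) (Q n) = (m == n)%:R].

Hypothesis brl : forall q, scalar (br ^~ q).
Hypothesis brr : forall p, scalar (br p).
Hypothesis biorth : biorthonormal.

Let sP n : size (P n) = n.+1. Proof. by case: biorth => /(_ n)[]. Qed.
Let sQ n : size (Q n) = n.+1. Proof. by case: biorth => _ /(_ n)[]. Qed.
Let lP n : (P n)`_n = S n.
Proof. by case: biorth => /(_ n)[sPn <-] _; rewrite lead_coefE sPn. Qed.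
Let PQ m n : br (P m) (Q n) = (m == n)%:R. Proof. by case: biorth. Qed.

Lemma biorth_lead_neq0 n : S n != 0.
Proof.
by case: biorth => /(_ n)[sPn <-] _; rewrite lead_coef_eq0 -size_poly_eq0 sPn.
Qed.

Lemma biorth_expand p n : (size p <= n)%N ->
  p = \sum_(k < n) br p (Q k) *: P k.
Proof.
move=> /(graded_basis sP)[c ->]; apply: eq_bigr => i _; congr (_ *: _).
rewrite (scalarf_sum n c P (brl _)) (bigD1 i) //= PQ eqxx mulr1 big1 ?addr0 //.
by move=> j ji; rewrite PQ (inj_eq val_inj) (negbTE ji) mulr0.
Qed.

Lemma biorth_orthr n q : (size q <= n)%N -> br (P n) q = 0.
Proof.
move=> /(graded_basis sQ)[c ->]; rewrite scalarf_sum // big1 // => i _.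
by rewrite PQ gtn_eqF ?mulr0.
Qed.

Lemma biorth_orthl n p : (size p <= n)%N -> br p (Q n) = 0.
Proof.
move=> /(graded_basis sP)[c ->]; rewrite (scalarf_sum n c P (brl _)) big1 // => i _.
by rewrite PQ ltn_eqF ?mulr0.
Qed.

Lemma size_X_biorth n : (size ('X * P n)%R <= n.+2)%N.
Proof. by rewrite mulrC size_mulX ?sP // -size_poly_eq0 sP. Qed.

(** After the top coefficients cancel, the remainder has degree at most [n] and is orthogonal to
    [Q n.+1]. *)
Lemma biorth_X_next n : br ('X * P n) (Q n.+1) = S n / S n.+1.
Proof.
have -> : 'X * P n = (S n / S n.+1) *: P n.+1 +
                     ('X * P n - (S n / S n.+1) *: P n.+1) by rewrite subrKC.
rewrite (scalarfD _ _ (brl _)) (scalarfZ _ _ (brl _)) PQ eqxx mulr1.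
rewrite [X in _ + X](@biorth_orthl n.+1) ?addr0 //.
apply/leq_sizeP => j; rewrite leq_eqVlt coefB coefZ coefXM => /predU1P[<-|nj].
  by rewrite /= !lP divfK ?biorth_lead_neq0 ?subrr.
rewrite [(P n.+1)`_j]nth_default ?mulr0 ?subr0 ?sP //.
by case: j nj => // j nj; rewrite nth_default // sP.
Qed.

End Biorthonormal.

Lemma biorthonormal_sym (F : fieldType) (br : {poly F} -> {poly F} -> F) S P Q :
  biorthonormal br S P Q -> biorthonormal (fun p q => br q p) S Q P.
Proof. by case=> hP hQ PQ; split=> // m n; rewrite PQ eq_sym. Qed.

(** * Recurrences with a rank-one tail and the Christoffel-Darboux formula *)

Section Recurrence.
Variables (F : fieldType) (br : {poly F} -> {poly F} -> F).
Variables (mu1 mu2 : {poly F} -> F).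
Variables (S : nat -> F) (P Q : nat -> {poly F}).
Hypothesis brl : forall q, scalar (br ^~ q).
Hypothesis brr : forall p, scalar (br p).
Hypothesis biorth : biorthonormal br S P Q.
Hypothesis br_rank1 :
  forall p q, br ('X * p) q + br p ('X * q) = mu1 p * mu2 q.

(** For [k + 1 < n] the polynomial ['X * Q k] has degree below [n], so the rank-one relation reduces
    the coefficient of [P k] to [mu1 (P n) * mu2 (Q k)]. The tail reaches down to [k = 0], but has
    rank one. *)
Lemma biorth_recurrence n :
  'X * P n = (S n / S n.+1) *: P n.+1 + br ('X * P n) (Q n) *: P n
    - (at_pred S n / S n) *: at_pred P n
    + mu1 (P n) *: \sum_(k < n) mu2 (Q k) *: P k.
Proof.
have sQ k : size (Q k) = k.+1 by case: biorth => _ /(_ k)[].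
rewrite [LHS](biorth_expand brl biorth (size_X_biorth biorth n)).
rewrite !big_ord_recr /= (biorth_X_next brl biorth).
rewrite addrC -!addrA; congr (_ + _); rewrite addrC; congr (_ + _).
have low k : (k.+1 < n)%N -> br ('X * P n) (Q k) = mu1 (P n) * mu2 (Q k).
  move=> kn; rewrite -br_rank1 [X in _ + X](biorth_orthr brr biorth) ?addr0 //.
  by rewrite mulrC size_mulX ?sQ // -size_poly_eq0 sQ.
case: n low => [|n] low; first by rewrite !big_ord0 /= !scaler0 oppr0 addr0.
rewrite !big_ord_recr /= scalerDr scalerA scaler_sumr.
(* Among the lower coefficients only this one has a nonzero [br (P n.+1) ('X * Q k)], computed by
   [biorth_X_next] for the transposed bracket. *)
have -> : br ('X * P n.+1) (Q n) = mu1 (P n.+1) * mu2 (Q n) - S n / S n.+1.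
  by rewrite -br_rank1 (biorth_X_next brr (biorthonormal_sym biorth)) addrK.
rewrite scalerBl addrA [RHS]addrC; congr (_ + _ - _).
by apply: eq_bigr => i _; rewrite scalerA low ?ltnS.
Qed.

End Recurrence.

Section ChristoffelDarboux.
Variables (F : fieldType) (br : {poly F} -> {poly F} -> F).
Variables (mu1 mu2 : {poly F} -> F).
Variables (S : nat -> F) (P Q : nat -> {poly F}).
Hypothesis brl : forall q, scalar (br ^~ q).
Hypothesis brr : forall p, scalar (br p).
Hypothesis biorth : biorthonormal br S P Q.
Hypothesis br_rank1 :
  forall p q, br ('X * p) q + br p ('X * q) = mu1 p * mu2 q.

Let E n := \sum_(k < n) mu2 (Q k) *: P k.
Let r n := S n / S n.+1.
Let r' n := at_pred S n / S n.
Let X n := br ('X * P n) (Q n).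
Let Y n := br (P n) ('X * Q n).

Let recP n : 'X * P n = r n *: P n.+1 + X n *: P n - r' n *: at_pred P n
   + mu1 (P n) *: E n.
Proof. exact: (biorth_recurrence brl brr biorth br_rank1 n). Qed.

Let recQ n : 'X * Q n = r n *: Q n.+1 + Y n *: Q n - r' n *: at_pred Q n
   + mu2 (Q n) *: \sum_(k < n) mu1 (P k) *: Q k.
Proof.
apply: (@biorth_recurrence F (fun p q => br q p) mu2 mu1 S Q P) => //.
  exact: biorthonormal_sym biorth.
by move=> p q; rewrite addrC br_rank1 mulrC.
Qed.

(* [L] ranges over evaluation at [z] ([kappa = 0]) and the Cauchy transform at
   [z] of the second weight ([kappa = 1]). *)
Variables (L : {poly F} -> F) (z kappa : F).
Hypothesis lL : scalar L.
Hypothesis LX : forall q, L ('X * q) = z * L q - kappa * mu2 q.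

(** This is [L] applied to the recurrence of [Q n] and solved for the tail; [kappa] joins the tail
    because [LX] also carries the factor [mu2 (Q n)]. *)
Lemma functional_recurrence n :
  mu2 (Q n) * (kappa + L (\sum_(k < n) mu1 (P k) *: Q k)) =
  (z - Y n) * L (Q n) - r n * L (Q n.+1) + r' n * at_pred (L \o Q) n.
Proof.
have /(congr1 L) := recQ n; rewrite LX -scaleNr !scalarfD // !scalarfZ //.
have -> : L (at_pred Q n) = at_pred (L \o Q) n by case: n; rewrite //= scalarf0.
move=> /eqP; rewrite -subr_eq0 => /eqP h; apply/eqP.
by rewrite -subr_eq0 -oppr_eq0 -h; apply/eqP; ring.
Qed.

(** Telescoping leaves the tail [E n] besides the two neighbours, since the recurrences have tails
    themselves. Up to the factor [mu2 (Q n)], its coefficient is the quantity given by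
    [functional_recurrence]. *)
Lemma christoffel_darboux n :
  ('X + z%:P) * \sum_(k < n) L (Q k) *: P k =
  (kappa + L (\sum_(k < n) mu1 (P k) *: Q k)) *: E n
  + (r' n * at_pred (L \o Q) n) *: P n + (r' n * L (Q n)) *: at_pred P n.
Proof.
elim: n => [|n IHn].
  by rewrite /E !big_ord0 mulr0 /= /r' /= mul0r mulr0 mul0r !scale0r scaler0 !addr0.
rewrite big_ord_recr mulrDr {}IHn /=.
have FR := functional_recurrence n.
rewrite [in RHS]/E !big_ord_recr /= -/(E n) scalarfD // [L (_ *: _)]scalarfZ // -[r' n.+1]/(r n).
rewrite -!scalerAr mulrDl recP -!mul_polyC.
have := br_rank1 (P n) (Q n); rewrite -/(X n) -/(Y n) => XY.
move: FR XY; set D := L _; set l := at_pred _ n; set p := at_pred P n => FR XY.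
(* The rank-one relation trades [X n] for [Y n], the parameter of the recurrence of [Q n]; the rest
   is [functional_recurrence]. *)
have -> : X n = mu1 (P n) * mu2 (Q n) - Y n by rewrite -XY addrK.
have FR' : r' n * l = mu2 (Q n) * (kappa + D) - (z - Y n) * L (Q n) + r n * L (Q n.+1).
  by rewrite FR; ring.
rewrite FR'; ring.
Qed.
End ChristoffelDarboux.

(** * The Euler operator x d/dx and the spectral relation *)

Section EulerOperator.
Variables (F : fieldType) (br : {poly F} -> {poly F} -> F).
Variables (S : nat -> F) (P Q : nat -> {poly F}).
Hypothesis brl : forall q, scalar (br ^~ q).
Hypothesis brr : forall p, scalar (br p).
Hypothesis biorth : biorthonormal br S P Q.

Lemma size_X_deriv (p : {poly F}) n : (size p <= n)%N -> (size ('X * p^`())%R <= n)%N.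
Proof.
move=> /leq_sizeP sp; apply/leq_sizeP => -[|j] nj; rewrite coefXM //=.
by rewrite coef_deriv sp // mul0rn.
Qed.

(** The operator x d/dx multiplies the leading coefficient by [n]; the remainder has degree below
    [n] and is orthogonal to [Q n]. *)
Lemma biorth_X_deriv n : br ('X * (P n)^`()) (Q n) = n%:R.
Proof.
have [sP lP] : size (P n) = n.+1 /\ lead_coef (P n) = S n by case: biorth => /(_ n).
have PQ : br (P n) (Q n) = 1 by case: biorth => _ _ ->; rewrite eqxx.
have -> : 'X * (P n)^`() = n%:R *: P n + ('X * (P n)^`() - n%:R *: P n).
  by rewrite subrKC.
rewrite (scalarfD _ _ (brl _)) (scalarfZ _ _ (brl _)) PQ mulr1.
rewrite [X in _ + X](biorth_orthl brl biorth) ?addr0 //.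
apply/leq_sizeP => j; rewrite leq_eqVlt coefB coefZ coefXM coef_deriv.
move=> /predU1P[<-|nj].
  by case: n {sP lP PQ} => [|n] /=; rewrite ?mulr0n ?mul0r ?mulr_natl subrr.
rewrite [(P n)`_j]nth_default ?sP // mulr0 subr0.
by case: j nj => // j nj /=; rewrite nth_default ?sP // mul0rn.
Qed.

End EulerOperator.

Section SpectralRelation.
Variables (F : fieldType) (br : {poly F} -> {poly F} -> F).
Variables (mu1 mu2 c1 c2 : {poly F} -> F).
Variables (S : nat -> F) (P Q : nat -> {poly F}) (A B s t c : F).
Hypothesis brl : forall q, scalar (br ^~ q).
Hypothesis brr : forall p, scalar (br p).
Hypothesis biorth : biorthonormal br S P Q.
Hypothesis br_rank1 :
  forall p q, br ('X * p) q + br p ('X * q) = mu1 p * mu2 q.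
Hypothesis lc2 : scalar c2.
Hypothesis c2X : forall q, c2 ('X * q) = - s * c2 q - mu2 q.
Hypothesis br_euler : forall p q,
  br ('X * p^`()) q + br p ('X * q^`()) + c * br p q =
  br ('X * p) q + br p ('X * q) - A * p.[s] * c2 q - B * c1 p * q.[t].

Lemma biorth_norm n : mu1 (P n) * mu2 (Q n) =
  n%:R + n%:R + c + A * (P n).[s] * c2 (Q n) + B * c1 (P n) * (Q n).[t].
Proof.
have PQ : br (P n) (Q n) = 1 by case: biorth => _ _ ->; rewrite eqxx.
have := br_euler (P n) (Q n).
rewrite (biorth_X_deriv brl biorth) (biorth_X_deriv brr (biorthonormal_sym biorth)).
by rewrite PQ br_rank1 mulr1 => ->; ring.
Qed.

(** For [k < n] both [Q k] and x times its derivative have degree below [n], so [br_euler] against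
    [Q k] keeps only the rank-one term and the two jump terms. *)
Lemma biorth_euler n : 'X * (P n)^`() = n%:R *: P n +
  (mu1 (P n) *: (\sum_(k < n) mu2 (Q k) *: P k)
   - (A * (P n).[s]) *: (\sum_(k < n) c2 (Q k) *: P k)
   - (B * c1 (P n)) *: (\sum_(k < n) (Q k).[t] *: P k)).
Proof.
have sP : size (P n) = n.+1 by case: biorth => /(_ n)[].
have sQ k : size (Q k) = k.+1 by case: biorth => _ /(_ k)[].
have := @biorth_expand F br S P Q brl biorth ('X * (P n)^`()) n.+1.
rewrite size_X_deriv ?sP // => /(_ isT) {1}->; rewrite big_ord_recr /=.
rewrite (biorth_X_deriv brl biorth) addrC; congr (_ + _).
rewrite !scaler_sumr -!sumrB; apply: eq_bigr => k _.
rewrite !scalerA -!scalerBl; congr (_ *: _).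
have := br_euler (P n) (Q k).
rewrite br_rank1 (biorth_orthr brr biorth (n := n) (q := Q k)) ?sQ //.
rewrite (biorth_orthr brr biorth) ?mulr0 ?addr0 //.
exact: (leq_trans (size_X_deriv (eq_leq (sQ k))) (ltn_ord k)).
Qed.

Variable n : nat.
Hypothesis mu_neq0 : mu1 (P n) * mu2 (Q n) != 0.

Let r := S n / S n.+1.
Let r' := at_pred S n / S n.
Let X := br ('X * P n) (Q n).
Let Y := br (P n) ('X * Q n).
Let As := A / (mu1 (P n) * mu2 (Q n)) * (P n).[s].
Let Bt := B / (mu1 (P n) * mu2 (Q n)) * c1 (P n).
Let xs : {poly F} := 'X - s%:P.
Let xt : {poly F} := 'X + t%:P.
Let U k := c2 (Q k).
Let V k := (Q k).[t].

Lemma spectral_relation :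
  'X * xs * xt * (P n)^`() =
    (r *: (- (xs * xt)
        - As *: xt * (r * U n.+1 + (Y + s) * U n - r' * at_pred U n)%:P
        - Bt *: xs * (r * V n.+1 + (Y - t) * V n - r' * at_pred V n)%:P)) * P n.+1
  + (xs * xt * ('X + (Y - n%:R - c)%:P)
        - As *: xt * ((X%:P - 'X) * (r * U n.+1)%:P
                      + (Y%:P + 'X) * ((X - s) * U n)%:P
                      + (Y%:P + 'X) * (r' * at_pred U n)%:P)
        - Bt *: xs * ((X%:P - 'X) * (r * V n.+1)%:P
                      + (Y%:P + 'X) * ((X + t) * V n)%:P
                      + (Y%:P + 'X) * (r' * at_pred V n)%:P)) * P n
  + (r' *: (xs * xt
        + As *: xt * (r * U n.+1 - (X - s) * U n - r' * at_pred U n)%:P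
        + Bt *: xs * (r * V n.+1 - (X + t) * V n - r' * at_pred V n)%:P)) * at_pred P n.
Proof.
have lV : scalar (fun q : {poly F} => q.[t]) by move=> k p q; rewrite hornerD hornerZ.
have VX q : ('X * q).[t] = t * q.[t] - 0 * mu2 q.
  by rewrite hornerM hornerX mul0r subr0.
have c2X' q : c2 ('X * q) = - s * c2 q - 1 * mu2 q by rewrite mul1r.
have CU := christoffel_darboux brl brr biorth br_rank1 lc2 c2X' n.
have CV := christoffel_darboux brl brr biorth br_rank1 lV VX n.
have FU := functional_recurrence brl brr biorth br_rank1 lc2 c2X' n.
have FV := functional_recurrence brl brr biorth br_rank1 lV VX n.
have RP := biorth_recurrence brl brr biorth br_rank1 n.
have N := biorth_norm n; have := br_rank1 (P n) (Q n); rewrite -/X -/Y => XY.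
have -> : 'X * xs * xt * (P n)^`() = xs * xt * ('X * (P n)^`()) by ring.
rewrite biorth_euler.
rewrite -/X -/Y -/r -/r' -/U -/V in CU CV FU FV RP.
move: CU CV FU FV RP N XY mu_neq0.
rewrite -/xt polyCN -/xs.
have -> : at_pred (c2 \o Q) n = at_pred U n by [].
have -> : at_pred ((fun q : {poly F} => q.[t]) \o Q) n = at_pred V n by [].
rewrite -[c2 (Q n)]/(U n) -[(Q n).[t]]/(V n) -[c2 (Q n.+1)]/(U n.+1)
  -[(Q n.+1).[t]]/(V n.+1) /As /Bt.
rewrite -[\sum_(k < n) c2 _ *: _]/(\sum_(k < n) U k *: P k).
move: (\sum_(k < n) U k *: P k) (\sum_(k < n) V k *: P k) => sU sV.
move: (\sum_(k < n) mu2 (Q k) *: P k) => E.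
(* [DU] and [DV] are the coefficients of [E] in the two Christoffel-Darboux formulas: [kappa] is 1
   for the Cauchy transform and 0 for evaluation. *)
move: (1 + _) (0 + _) => DU DV.
move: (at_pred P n) (at_pred U n) (at_pred V n) => p' u' v'.
move: (U n.+1) (U n) (V n.+1) (V n) => u1 u v1 v.
move: (P n.+1) (P n).[s] (c1 (P n)) => p1 ps cp.
move: (mu1 (P n)) (mu2 (Q n)) => m1 m2.
move: (P n) X Y r r' n%:R => p X0 Y0 r0 r0' nn.
move=> CU CV FU FV RP N XY m0.
(* Writing [A] as a multiple of [m1 * m2] keeps inverses away from [ring]: [m2] goes to [DU] and
   [m1] to [E], as [FU] and [ME] require. *)
have [A' AE] : exists A', A = A' * (m1 * m2) by exists (A / (m1 * m2)); rewrite divfK.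
have [B' BE] : exists B', B = B' * (m1 * m2) by exists (B / (m1 * m2)); rewrite divfK.
have ME : m1%:P * E = 'X * p - r0%:P * p1 - X0%:P * p + r0'%:P * p'.
  by rewrite -!mul_polyC in RP; rewrite RP; ring.
have AU : (A * ps)%:P * (xs * sU) = (A' * ps)%:P * (m2 * DU)%:P * (m1%:P * E)
   + (A * ps)%:P * ((r0' * u')%:P * p + (r0' * u)%:P * p').
  by rewrite CU AE -!mul_polyC; ring.
have BV : (B * cp)%:P * (xt * sV) = (B' * cp)%:P * (m2 * DV)%:P * (m1%:P * E)
   + (B * cp)%:P * ((r0' * v')%:P * p + (r0' * v)%:P * p').
  by rewrite CV BE -!mul_polyC; ring.
rewrite -!mul_polyC.
transitivity (xs * xt * (nn%:P * p + m1%:P * E)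
   - xt * ((A * ps)%:P * (xs * sU)) - xs * ((B * cp)%:P * (xt * sV))); first by ring.
rewrite AU BV ME FU FV.
have -> : A / (m1 * m2) = A' by rewrite AE mulfK.
have -> : B / (m1 * m2) = B' by rewrite BE mulfK.
(* [biorth_norm] replaces [c]. Its jump terms supply the gap (X + Y)(x - s) between (Y + x)(X - s)
   and the computed (X - x)(Y + s), and likewise (X + Y)(x + t) at [t]. *)
have -> : c = X0 + Y0 - nn - nn - A * ps * u - B * cp * v by rewrite XY N; ring.
rewrite AE BE -XY /xs /xt; ring.
Qed.
End SpectralRelation.

(** * Complex-valued integrals *)

Section ComplexIntegralTheory.
Context (d : measure_display) (T : measurableType d) (R : realType).
Variables (mu : {measure set T -> \bar R}) (D : set T).
Hypothesis mD : measurable D.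
Implicit Types (f g : T -> R[i]) (h : T -> R) (k : R[i]).

Lemma eq_cintegrable f g : {in D, f =1 g} ->
  cintegrable mu D f -> cintegrable mu D g.
Proof.
by move=> fg [ref imf]; split; [move: ref | move: imf]; apply: eq_integrable => // x xD;
  rewrite /= fg.
Qed.

Lemma eq_cintegral f g : {in D, f =1 g} -> cintegral mu D f = cintegral mu D g.
Proof.
by move=> fg; congr (_ +i* _); apply: eq_Rintegral => x xD; rewrite fg.
Qed.

Lemma cintegrableD f g : cintegrable mu D f -> cintegrable mu D g ->
  cintegrable mu D (fun x => f x + g x).
Proof.
move=> [rf jf] [rg jg]; split.
  by apply: eq_integrable (integrableD mD rf rg) => // x _ /=; case: (f x) (g x) => ? ? [].
by apply: eq_integrable (integrableD mD jf jg) => // x _ /=; case: (f x) (g x) => ? ? [].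
Qed.

Lemma cintegralD f g : cintegrable mu D f -> cintegrable mu D g ->
  cintegral mu D (fun x => f x + g x) = cintegral mu D f + cintegral mu D g.
Proof.
move=> [rf jf] [rg jg]; rewrite /cintegral; apply/eqP; rewrite eq_complex /=.
by rewrite -!RintegralD //; apply/andP; split; apply/eqP/eq_Rintegral => x _;
  case: (f x) (g x) => ? ? [].
Qed.

Lemma cintegrableZ k f : cintegrable mu D f -> cintegrable mu D (fun x => k * f x).
Proof.
case: k => a b [rf jf]; split.
  apply: eq_integrable (integrableB mD (integrableZl mD a rf) (integrableZl mD b jf)) => //.
  by move=> x _ /=; case: (f x).
apply: eq_integrable (integrableD mD (integrableZl mD a jf) (integrableZl mD b rf)) => //.
by move=> x _ /=; case: (f x).
Qed.

Lemma cintegralZ k f : cintegrable mu D f ->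
  cintegral mu D (fun x => k * f x) = k * cintegral mu D f.
Proof.
case: k => a b [rf jf]; rewrite /cintegral; apply/eqP; rewrite eq_complex /=.
have Z c h : mu.-integrable D (EFin \o h) ->
    mu.-integrable D (EFin \o (fun x => c * h x)).
  by move=> ih; apply: eq_integrable (integrableZl mD c ih).
rewrite -!RintegralZl // -RintegralB -?RintegralD //; try exact: Z.
by apply/andP; split; apply/eqP/eq_Rintegral => x _; case: (f x).
Qed.

Lemma cintegrableMr f h (M : R) : measurable_fun D h ->
  (forall x, D x -> `|h x| <= M) ->
  cintegrable mu D f -> cintegrable mu D (fun x => f x * (h x)%:C).
Proof.
move=> mh hM [rf jf].
have bh : [bounded h x | x in D].
  exists M; split; first exact: num_real.
  by move=> N MN x Dx /=; rewrite (le_trans (hM _ Dx)) // ltW.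
split.
  apply: eq_integrable (integrableMl mD rf mh bh) => // x _ /=.
  by case: (f x) => a b /=; rewrite mulr0 subr0.
apply: eq_integrable (integrableMl mD jf mh bh) => // x _ /=.
by case: (f x) => a b /=; rewrite mulr0 add0r.
Qed.

End ComplexIntegralTheory.

(** * Fubini's theorem on a rectangle *)

Section RectangleFubini.
Context (d1 d2 : measure_display) (T1 : measurableType d1) (T2 : measurableType d2).
Context (R : realType).
Variables (m1 : {sigma_finite_measure set T1 -> \bar R})
  (m2 : {sigma_finite_measure set T2 -> \bar R}) (D1 : set T1) (D2 : set T2).
Hypotheses (mD1 : measurable D1) (mD2 : measurable D2).

Let mD : measurable (D1 `*` D2). Proof. exact: measurableX. Qed.

(** Extension by zero turns the rectangle into the whole product space; a slice at [y] outside [D2]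
    then integrates to 0. *)
Lemma integral_rectangle21 (f : T1 * T2 -> \bar R) (g : T2 -> \bar R) :
  (m1 \x m2)%E.-integrable (D1 `*` D2) f ->
  (forall y, D2 y -> \int[m1]_(x in D1) f (x, y) = g y)%E ->
  (\int[(m1 \x m2)%E]_(z in D1 `*` D2) f z = \int[m2]_(y in D2) g y)%E.
Proof.
move=> /(integrable_mkcond _ mD) if_ fg.
rewrite integral_mkcond -integral21_prod_meas1 // [RHS]integral_mkcond.
apply: eq_integral => y _; rewrite /fubini_G patchE.
case: ifPn => [/set_mem yD|/negP yD].
  rewrite -fg // [RHS]integral_mkcond; apply: eq_integral => x _.
  by rewrite !patchE in_setX /= (mem_set yD) andbT.
rewrite integral0_eq // => x _; rewrite patchE in_setX /=.
by move: yD => /negP/negbTE ->; rewrite andbF.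
Qed.

Lemma integral_rectangle12 (f : T1 * T2 -> \bar R) (g : T1 -> \bar R) :
  (m1 \x m2)%E.-integrable (D1 `*` D2) f ->
  (forall x, D1 x -> \int[m2]_(y in D2) f (x, y) = g x)%E ->
  (\int[(m1 \x m2)%E]_(z in D1 `*` D2) f z = \int[m1]_(x in D1) g x)%E.
Proof.
move=> /(integrable_mkcond _ mD) if_ fg.
rewrite integral_mkcond -integral12_prod_meas1 // [RHS]integral_mkcond.
apply: eq_integral => x _; rewrite /fubini_F patchE.
case: ifPn => [/set_mem xD|/negP xD].
  rewrite -fg // [RHS]integral_mkcond; apply: eq_integral => y _.
  by rewrite !patchE in_setX /= (mem_set xD).
rewrite integral0_eq // => y _; rewrite patchE in_setX /=.
by move: xD => /negP/negbTE ->.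
Qed.

Lemma cintegral_rectangle21 (f : T1 * T2 -> R[i]) (g : T2 -> R[i]) :
  cintegrable (m1 \x m2)%E (D1 `*` D2) f ->
  (forall y, D2 y -> cintegrable m1 D1 (fun x => f (x, y))) ->
  (forall y, D2 y -> cintegral m1 D1 (fun x => f (x, y)) = g y) ->
  cintegral (m1 \x m2)%E (D1 `*` D2) f = cintegral m2 D2 g.
Proof.
(* Integrability of the slices makes the inner integrals finite, so [fine] loses nothing on them. *)
move=> [rf jf] fi fg; congr (_ +i* _); congr fine;
  apply: integral_rectangle21 => // y Dy; have [ri ji] := fi y Dy;
  rewrite -(fg y Dy) /cintegral /= /Rintegral fineK //.
  exact: (integrable_fin_num mD1 ri).
exact: (integrable_fin_num mD1 ji).
Qed.

Lemma cintegral_rectangle12 (f : T1 * T2 -> R[i]) (g : T1 -> R[i]) :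
  cintegrable (m1 \x m2)%E (D1 `*` D2) f ->
  (forall x, D1 x -> cintegrable m2 D2 (fun y => f (x, y))) ->
  (forall x, D1 x -> cintegral m2 D2 (fun y => f (x, y)) = g x) ->
  cintegral (m1 \x m2)%E (D1 `*` D2) f = cintegral m1 D1 g.
Proof.
move=> [rf jf] fi fg; congr (_ +i* _); congr fine;
  apply: integral_rectangle12 => // x Dx; have [ri ji] := fi x Dx;
  rewrite -(fg x Dx) /cintegral /= /Rintegral fineK //.
  exact: (integrable_fin_num mD2 ri).
exact: (integrable_fin_num mD2 ji).
Qed.

End RectangleFubini.

(** * Improper integrals on the half-line *)

Section ImproperIntegral.
Variable R : realType.
Local Notation mu := (@lebesgue_measure R).
Implicit Types (F G : R -> R) (x y : R).

Lemma halflineE (x : R) : halfline x = (0 < x) :> Prop.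
Proof. by rewrite /halfline /= in_itv /= andbT. Qed.

Lemma measurable_halfline :
  @measurable _ (g_sigma_algebraType R.-ocitv.-measurable) (@halfline R).
Proof. exact: measurable_itv. Qed.

Lemma measurable_fun_halfline G : (forall x, 0 < x -> {for x, continuous G}) ->
  measurable_fun (@halfline R) G.
Proof.
move=> cG; apply: open_continuous_measurable_fun; first exact: interval_open.
by move=> x /set_mem; rewrite halflineE; exact: cG.
Qed.

Lemma derive_continuous F (x df : R) : is_derive x 1 F df -> {for x, continuous F}.
Proof.
by move=> [dF _]; apply/differentiable_continuous; rewrite -derivable1_diffP.
Qed.

Lemma FTC_pos F G (a b : R) : 0 < a -> a < b ->
  (forall x, 0 < x -> is_derive x 1 F (G x)) ->
  (forall x, 0 < x -> {for x, continuous G}) ->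
  (\int[mu]_(x in `[a, b]) (G x)%:E = (F b - F a)%:E)%E.
Proof.
move=> a0 ab dF cG; rewrite EFinB; apply: continuous_FTC2 => //.
- apply: continuous_in_subspaceT => x /[!inE]/= /[!in_itv]/= /andP[ax _].
  exact/cG/(lt_le_trans a0).
- have cF x : 0 < x -> {for x, continuous F}.
    by move=> x0; apply: derive_continuous (dF x x0).
  split.
  + move=> x /[!in_itv]/= /andP[ax _]; have [] // := dF x (lt_trans a0 ax).
  + exact: cvg_at_right_filter (cF _ a0).
  + exact: cvg_at_left_filter (cF _ (lt_trans a0 ab)).
- move=> x /[!in_itv]/= /andP[ax _].
  by rewrite derive1E; have [_ ->] := dF x (lt_trans a0 ax).
Qed.

(** Dominated convergence with bound |G|, along intervals that eventually contain each point of [D].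
    Leaving [D] free covers both the half-line and []s, +oo[]. *)
Lemma improper_FTC F G (D : set R) (a b : nat -> R) (la lb : R) :
  measurable D ->
  (forall x, 0 < x -> is_derive x 1 F (G x)) ->
  (forall x, 0 < x -> {for x, continuous G}) ->
  mu.-integrable D (EFin \o G) ->
  (forall n, 0 < a n < b n) -> (forall n, `[a n, b n] `<=` D) ->
  (forall x, D x -> \forall n \near \oo, a n <= x <= b n) ->
  F (a n) @[n --> \oo] --> la -> F (b n) @[n --> \oo] --> lb ->
  \int[mu]_(x in D) G x = lb - la.
Proof.
move=> mD dF cG iG ab abD Dab Fa Fb.
have cvgD : (\int[mu]_(x in D) (((EFin \o G) \_ `[a n, b n]) x) @[n --> \oo]
    --> \int[mu]_(x in D) (EFin \o G) x)%E.
  have iaG := integrable_abse iG.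
  apply: (@dominated_cvg _ _ _ mu D mD _ _ (abse \o (EFin \o G))) => //.
  - move=> n; have [+ _] := @measurable_restrict _ _ _ _ _ _ (EFin \o G)
      (measurable_itv `[a n, b n]) mD.
    by apply; apply: measurable_funS (measurable_int _ iG) => //; apply: subIsetr.
  - move=> x /Dab xab; apply: cvg_near_cst; apply: filterS xab => n xab.
    by rewrite patchE mem_set //= in_itv.
  - move=> n x Dx; rewrite patchE; case: ifP => _ //=.
    by rewrite normr0 lee_fin.
have E n : (\int[mu]_(x in D) (((EFin \o G) \_ `[a n, b n]) x) =
    (F (b n) - F (a n))%:E)%E.
  have /andP[a0 anb] := ab n.
  by rewrite -integral_mkcondr setIidr // (FTC_pos a0 anb dF cG).
have cvgE : ((F (b n) - F (a n))%:E @[n --> \oo] --> (lb - la)%:E)%E.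
  by apply: cvg_EFin; [exact: nearW|exact: cvgB].
rewrite /Rintegral -[RHS]/(fine (lb - la)%:E); congr fine.
move: cvgD; rewrite (funext E) => cvgD.
exact: (cvg_unique _ cvgD cvgE).
Qed.

(** Monotone convergence: each truncated integral is a difference of two values of [F], hence at
    most [M]. *)
Lemma integrable_bounded_primitive F G (M : R) :
  (forall x, 0 < x -> is_derive x 1 F (G x)) ->
  (forall x, 0 < x -> {for x, continuous G}) ->
  (forall x, 0 < x -> 0 <= G x) -> (forall x, 0 < x -> 0 <= F x <= M) ->
  mu.-integrable (@halfline R) (EFin \o G).
Proof.
move=> dF cG G0 FM.
(* With [n.+2] the endpoints stay distinct even at [n = 0], as [FTC_pos] requires. *)
pose I (n : nat) : set R := `[(n.+2%:R)^-1, n.+2%:R]%classic.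
have I0 n x : I n x -> 0 < x.
  by rewrite /I /= in_itv /= => /andP[+ _]; apply: lt_le_trans; rewrite invr_gt0.
have HE : @halfline R = \bigcup_n I n.
  apply/seteqP; split=> x; last by move=> [n _ /I0 x0]; rewrite halflineE.
  rewrite halflineE => x0.
  (* The sum [x + x^-1] exceeds both terms, so one index serves both endpoints. *)
  exists (Num.truncn (x + x^-1)) => //; rewrite /I /= in_itv /=.
  have := truncnS_gt (x + x^-1); set m := Num.truncn _ => xm.
  have mm : m.+1%:R <= m.+2%:R :> R by rewrite ler_nat.
  have xi : 0 < x^-1 by rewrite invr_gt0.
  apply/andP; split; last by lra.
  rewrite -[leRHS]invrK lef_pV2 ?posrE //; lra.
have mG := measurable_fun_halfline cG.
apply/integrableP; split; first exact/measurable_EFinP.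
have absG : forall x, x \in @halfline R -> (`|(EFin \o G) x| = (G x)%:E)%E.
  move=> x /set_mem; rewrite halflineE => x0.
  by rewrite /= ger0_norm // G0.
have -> : (\int[mu]_(x in @halfline R) `|(EFin \o G) x| = \int[mu]_(x in @halfline R) (G x)%:E)%E
  by apply: eq_integral => x; exact: absG.
rewrite HE.
have cvgI : (\int[mu]_(x in I n) (G x)%:E @[n --> \oo] -->
    \int[mu]_(x in \bigcup_n I n) (G x)%:E)%E.
  apply: ge0_nondecreasing_set_cvg_integral.
  - move=> m n mn; apply/subsetPset => x; rewrite /I /= !in_itv /= => /andP[h1 h2].
    have mn' : m.+2%:R <= n.+2%:R :> R by rewrite ler_nat.
    rewrite (le_trans _ h1) ?(le_trans h2) //.
    by rewrite lef_pV2 // posrE.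
  - by move=> n; exact: measurable_itv.
  - move=> n; apply/measurable_EFinP; apply: measurable_funS mG.
      exact: measurable_halfline.
    by move=> x /I0 x0; rewrite halflineE.
  - by move=> n x /I0 x0; rewrite lee_fin G0.
apply: (@le_lt_trans _ _ M%:E); last exact: ltry.
move/cvg_lim : (cvgI) => <- //; apply: lime_le.
  by apply/cvg_ex; eexists; exact: cvgI.
apply: nearW => n.
have n0 : 0 < (n.+2%:R)^-1 :> R by rewrite invr_gt0.
have nn : (n.+2%:R)^-1 < n.+2%:R :> R.
  by rewrite (@lt_le_trans _ _ 1) ?ler1n // invf_lt1 ?ltr1n.
rewrite (FTC_pos n0 nn dF cG) lee_fin.
by have := FM _ n0; have := FM _ (lt_trans n0 nn); lra.
Qed.

End ImproperIntegral.

(** * Gamma densities *)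

Section GammaDensity.
Variable R : realType.
Local Notation mu := (@lebesgue_measure R).
Implicit Types (k x y : R).

(** The maximum, at [x = k], is [k * ln k - k]; the inequality ln u < u at u = x / k gives this
    slightly weaker bound. *)
Lemma mul_ln_sub_le k x : 0 < k -> 0 < x -> k * ln x - x <= k * ln k.
Proof.
move=> k0 x0; have xk : 0 < x / k by rewrite divr_gt0.
have := ln_sublinear xk; rewrite ln_div // => /ltW.
rewrite -(ler_pM2l k0) mulrBr mulrCA divff ?gt_eqF // mulr1; lra.
Qed.

(* [x ^ (k - 1) * e ^ (- x)]; only meaningful for [x > 0]. *)
Definition gammad k x : R := expR (k * ln x - x) / x.

Lemma gammad_ge0 k x : 0 < x -> 0 <= gammad k x.
Proof. by move=> x0; rewrite divr_ge0 ?expR_ge0 // ltW. Qed.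

Lemma gammadS k x : 0 < x -> gammad (k + 1) x = gammad k x * x.
Proof.
move=> x0; rewrite /gammad mulrDl mul1r addrAC expRD lnK ?posrE //.
by rewrite mulrAC.
Qed.

Lemma continuous_ln_comp (f : R -> R) k x : 0 < x -> continuous f ->
  {for x, continuous (fun x => f (k * ln x))}.
Proof.
move=> x0 cf; apply: (@continuous_comp _ _ _ (fun x => k * ln x) f); last exact: cf.
by apply: cvgM; [exact: cvg_cst|exact: continuous_ln].
Qed.

Lemma continuous_gammad k x : 0 < x -> {for x, continuous (gammad k)}.
Proof.
move=> x0; apply: cvgM; last by apply: cvgV; [rewrite gt_eqF|exact: cvg_id].
apply: (@continuous_comp _ _ _ (fun x => k * ln x - x) expR); last exact: continuous_expR.
by apply: cvgB; [apply: cvgM; [exact: cvg_cst|exact: continuous_ln]|exact: cvg_id].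
Qed.

Lemma is_derive_expR_ln k x : 0 < x ->
  is_derive x 1 (fun x => expR (k * ln x)) (expR (k * ln x) * (k / x)).
Proof.
move=> x0; have dln := is_derive1_ln x0.
have dk : is_derive x 1 (fun x => k * ln x) (k / x) := is_deriveZ k dln.
exact: (@is_derive1_comp _ expR (fun x => k * ln x) _ _ _ (is_derive_expR _) dk).
Qed.

(* Comparison with the derivative [G] of the bounded function
   [x ^ k / (1 + x ^ k)]. *)
Lemma integrable_gammad k : 0 < k ->
  mu.-integrable (@halfline R) (EFin \o gammad k).
Proof.
move=> k0.
pose u x := expR (k * ln x); pose G x := (k / x) * u x / (1 + u x) ^+ 2.
have u0 x : 0 < u x by exact: expR_gt0.
have u1 x : 0 < 1 + u x by rewrite ltr_wpDl.
have iG : mu.-integrable (@halfline R) (EFin \o G).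
  apply: (@integrable_bounded_primitive R (fun x => 1 - (1 + u x)^-1) G 1).
  - move=> x x0; have d1 : is_derive x 1 (fun x => 1 + u x) (u x * (k / x)).
      have := is_deriveD (is_derive_cst (1 : R) x 1) (is_derive_expR_ln k x0).
      by rewrite add0r.
    have d2 := @is_deriveV _ (fun x => 1 + u x) _ _ _ (lt0r_neq0 (u1 x)) d1.
    have d3 : is_derive x 1 (fun x => 1 - (1 + u x)^-1) _ :=
      is_deriveB (is_derive_cst (1 : R) x 1) d2.
    apply: (is_derive_eq d3); rewrite /G sub0r scaleNr opprK.
    by rewrite /GRing.scale /= mulrC [u x * _]mulrC.
  - move=> x x0; have cu : {for x, continuous u}.
      by apply: continuous_ln_comp => //; exact: continuous_expR.
    apply: cvgM; first apply: cvgM => //.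
      by apply: cvgM; [exact: cvg_cst|apply: cvgV; [rewrite gt_eqF|exact: cvg_id]].
    apply: cvgV; first by rewrite expf_neq0 // gt_eqF.
    have c1 : {for x, continuous (fun x => 1 + u x)} by apply: cvgD => //; exact: cvg_cst.
    exact: (cvgM c1 c1).
  - move=> x x0; rewrite divr_ge0 ?sqr_ge0 // mulr_ge0 ?(ltW (u0 _)) //.
    by rewrite divr_ge0 // ltW.
  - move=> x x0; rewrite subr_ge0 invf_le1 // lerDl (ltW (u0 x)) /=.
    by rewrite gerBl invr_ge0 ltW.
(* From (1 + u)^2 <= 2 + 2 u^2, where u^2 exp(-x) is bounded by [mul_ln_sub_le] at exponent [2 * k];
   the division undoes the factor [k] in [G]. *)
pose K := (2 + 2 * expR (2 * k * ln (2 * k))) / k.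
apply: (le_integrable (@measurable_halfline R) _ _ (integrableZl (@measurable_halfline R) K iG)).
- apply/measurable_EFinP; exact: (measurable_fun_halfline (@continuous_gammad k)).
- move=> x; rewrite halflineE => x0 /=.
  rewrite lee_fin ger0_norm ?gammad_ge0 //; apply: le_trans (ler_norm _).
  have uu : u x ^+ 2 * expR (- x) <= expR (2 * k * ln (2 * k)).
    rewrite /u -expRM_natl -expRD ler_expR mulrA.
    by rewrite mul_ln_sub_le // mulr_gt0.
  have e1 : expR (- x) <= 1 by rewrite expR_le1 oppr_le0 ltW.
  have e0 : 0 < expR (- x) by exact: expR_gt0.
  have bd : (1 + u x) ^+ 2 * expR (- x) <= 2 + 2 * expR (2 * k * ln (2 * k)).
    have : 0 <= (1 - u x) ^+ 2 * expR (- x) by rewrite mulr_ge0 ?sqr_ge0 // ltW.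
    have -> : (1 + u x) ^+ 2 * expR (- x) =
      2 * expR (- x) + 2 * (u x ^+ 2 * expR (- x)) - (1 - u x) ^+ 2 * expR (- x) by ring.
    by lra.
  have -> : K * G x = (2 + 2 * expR (2 * k * ln (2 * k))) * (u x / x / (1 + u x) ^+ 2).
    rewrite /K /G; field; rewrite !gt_eqF //.
  rewrite /gammad expRD -/(u x).
  have -> : u x * expR (- x) / x = ((1 + u x) ^+ 2 * expR (- x)) * (u x / x / (1 + u x) ^+ 2).
    by field; rewrite !gt_eqF.
  by rewrite ler_pM2r // !divr_gt0 // exprn_gt0.
Qed.

Lemma integrable_gammadM k (h : R -> R) (M : R) : 0 < k ->
  measurable_fun (@halfline R) h -> (forall x, 0 < x -> `|h x| <= M) ->
  mu.-integrable (@halfline R) (EFin \o (fun x => gammad k x * h x)).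
Proof.
move=> k0 mh hM.
have bh : [bounded h x | x in @halfline R].
  exists M; split; first exact: num_real.
  by move=> N MN x; rewrite halflineE => x0 /=; rewrite (le_trans (hM _ x0)) // ltW.
exact: (@integrableMl _ _ R mu _ (@measurable_halfline R) _ h (integrable_gammad k0) mh bh).
Qed.

End GammaDensity.

Lemma normB_le (R : realType) (k x z : R) : 0 < k -> 0 < x -> 0 <= z -> z <= 1 ->
  `|k - x - z| <= k + x + 1.
Proof. by move=> k0 x0 z0 z1; rewrite ler_norml; apply/andP; split; lra. Qed.

(** * Integration by parts for the real components of a weight *)

Section RealParts.
Variables (R : realType) (k beta y : R).
Hypotheses (k0 : 0 < k) (y0 : 0 < y).
Local Notation mu := (@lebesgue_measure R).
Implicit Types (x p q : R).

(** The real part of (p - i q) x^(i beta). This family is stable under x d/dx, which sends (p, q) to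
    beta (q, -p); the pairs (1, 0) and (0, 1) give the real and imaginary parts of x^(i beta). *)
Definition wave p q x : R := p * cos (beta * ln x) + q * sin (beta * ln x).

Lemma wave_le p q x : `|wave p q x| <= `|p| + `|q|.
Proof.
apply: le_trans (ler_normD _ _) _; rewrite !normrM.
by apply: lerD; rewrite ler_piMr // ?cos_max ?sin_max.
Qed.

Lemma continuous_wave p q x : 0 < x -> {for x, continuous (wave p q)}.
Proof.
move=> x0; apply: cvgD; apply: cvgM; try exact: cvg_cst; apply: continuous_ln_comp => //.
  exact: continuous_cos.
exact: continuous_sin.
Qed.

Lemma is_derive_wave p q x : 0 < x ->
  is_derive x 1 (wave p q) (beta / x * wave q (- p) x).
Proof.
move=> x0; have dln := is_derive1_ln x0.
have dk : is_derive x 1 (fun x => beta * ln x) (beta / x) := is_deriveZ beta dln.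
have dc := @is_derive1_comp _ (@cos R) (fun x => beta * ln x) _ _ _ (is_derive_cos _) dk.
have ds := @is_derive1_comp _ (@sin R) (fun x => beta * ln x) _ _ _ (is_derive_sin _) dk.
have dw : is_derive x 1 (wave p q) _ := is_deriveD (is_deriveZ p dc) (is_deriveZ q ds).
by apply: (is_derive_eq dw); rewrite /wave /GRing.scale /=; ring.
Qed.

(** With [k] equal to Re c + 1, this is a real component of x w(x) / (x + y) with the jump factor
    removed. The extra x makes it vanish at 0. *)
Definition parts_primitive p q x : R := expR (k * ln x - x) / (x + y) * wave p q x.

Definition parts_density p q x : R := gammad k x *
  (((k - x - x / (x + y)) * wave p q x + beta * wave q (- p) x) / (x + y)).

Let xy0 x : 0 < x -> x + y != 0.
Proof. by move=> x0; rewrite gt_eqF // addr_gt0. Qed.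

Lemma is_derive_parts_primitive p q x : 0 < x ->
  is_derive x 1 (parts_primitive p q) (parts_density p q x).
Proof.
move=> x0; have dln := is_derive1_ln x0.
have dk : is_derive x 1 (fun x => k * ln x - x) (k / x - 1) :=
  is_deriveB (is_deriveZ k dln) (is_derive_id x 1).
have de := @is_derive1_comp _ (@expR R) (fun x => k * ln x - x) _ _ _ (is_derive_expR _) dk.
have dxy : is_derive x 1 (fun x => x + y) (1 + 0) :=
  is_deriveD (is_derive_id x 1) (is_derive_cst y x 1).
have di := @is_deriveV _ (fun x => x + y) _ _ _ (xy0 x0) dxy.
have dw := is_derive_wave p q x0.
have df : is_derive x 1 (parts_primitive p q) _ := is_deriveM (is_deriveM de di) dw.
apply: (is_derive_eq df); rewrite /parts_density /gammad /GRing.scale /=.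
have -> : ((expR \o (fun x => k * ln x - x)) * (fun y0 => (y0 + y)^-1)) x =
  expR (k * ln x - x) / (x + y) by [].
by field; rewrite xy0 // gt_eqF.
Qed.

Lemma continuous_parts_density p q x : 0 < x -> {for x, continuous (parts_density p q)}.
Proof.
move=> x0; have cxy : {for x, continuous (fun x => x + y)}.
  by apply: cvgD; [exact: cvg_id|exact: cvg_cst].
have cV : {for x, continuous (fun x => (x + y)^-1)} by apply: cvgV => //; exact: xy0.
apply: cvgM; first exact: continuous_gammad.
apply: cvgM => //; apply: cvgD; apply: cvgM; try exact: continuous_wave.
  apply: cvgB; last by apply: cvgM => //; exact: cvg_id.
  by apply: cvgB; [exact: cvg_cst|exact: cvg_id].
exact: cvg_cst.
Qed.

Lemma parts_density_le p q x : 0 < x -> `|parts_density p q x| <=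
  (`|p| + `|q|) * (k + 1 + `|beta|) / y * (gammad k x + gammad (k + 1) x).
Proof.
move=> x0; set V := `|p| + `|q|; set C := V * _ / y.
have g0 : 0 < gammad k x by rewrite divr_gt0 ?expR_gt0.
have V0 : 0 <= V by rewrite addr_ge0.
rewrite gammadS // -[X in X + _]mulr1 -mulrDr mulrCA normrM (gtr0_norm g0) ler_pM2l //.
have yx : 0 < x + y by rewrite addr_gt0.
rewrite normrM normfV (gtr0_norm yx) ler_pdivrMr //.
have x1 : x / (x + y) <= 1 by rewrite ler_pdivrMr // mul1r lerDl ltW.
have x2 : 0 <= x / (x + y) by rewrite divr_ge0 // ltW.
have n1 := normB_le k0 x0 x2 x1.
have h1 : `|(k - x - x / (x + y)) * wave p q x| <= (k + x + 1) * V.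
  by rewrite normrM; apply: ler_pM => //; exact: wave_le.
have h2 : `|beta * wave q (- p) x| <= `|beta| * V.
  by rewrite normrM ler_wpM2l // (le_trans (wave_le _ _ _)) // normrN addrC.
apply: le_trans (ler_normD _ _) _; apply: le_trans (lerD h1 h2) _.
have -> : C * (1 + x) * (x + y) = V * ((k + 1 + `|beta|) * (1 + x) * ((x + y) / y)).
  by rewrite /C; field; rewrite gt_eqF.
rewrite -mulrDl mulrC ler_wpM2l //.
have b0 : 0 <= `|beta| by [].
have : (k + x + 1 + `|beta|) <= (k + 1 + `|beta|) * (1 + x).
  have -> : (k + 1 + `|beta|) * (1 + x) = k + x + 1 + `|beta| + x * (k + `|beta|) by ring.
  by rewrite lerDl mulr_ge0 ?addr_ge0 // ltW.
move=> /le_trans; apply; rewrite ler_peMr //.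
  by rewrite mulr_ge0 // ?addr_ge0 // ltW.
by rewrite ler_pdivlMr // mul1r lerDr ltW.
Qed.

Lemma integrable_parts_density p q :
  mu.-integrable (@halfline R) (EFin \o parts_density p q).
Proof.
have k1 : 0 < k + 1 by rewrite addr_gt0.
have ig := integrableD (@measurable_halfline R) (integrable_gammad k0) (integrable_gammad k1).
have iC := integrableZl (@measurable_halfline R) ((`|p| + `|q|) * (k + 1 + `|beta|) / y) ig.
apply: (@le_integrable _ _ R mu _ (@measurable_halfline R) (EFin \o parts_density p q) _ _ _ iC).
  apply/measurable_EFinP.
  exact: (measurable_fun_halfline (@continuous_parts_density p q)).
move=> x; rewrite halflineE => x0 /=; rewrite lee_fin; apply: le_trans (ler_norm _).
exact: parts_density_le.
Qed.

Lemma parts_primitive_le p q x : 0 < x ->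
  `|parts_primitive p q x| <= (`|p| + `|q|) / y * expR (k * ln x - x).
Proof.
move=> x0; have yx : 0 < x + y by rewrite addr_gt0.
rewrite !normrM normfV (gtr0_norm yx) (gtr0_norm (expR_gt0 _)).
rewrite -mulrA [leRHS]mulrC ler_pM2l ?expR_gt0 // mulrC.
apply: ler_pM => //; [by rewrite invr_ge0 ltW|exact: wave_le|].
by rewrite lef_pV2 ?posrE // lerDr ltW.
Qed.

Lemma parts_primitive_cvg p q (u : nat -> R) : (forall n, 0 < u n) ->
  expR (k * ln (u n) - u n) @[n --> \oo] --> (0 : R) ->
  parts_primitive p q (u n) @[n --> \oo] --> (0 : R).
Proof.
move=> u0 eu; pose C := (`|p| + `|q|) / y.
have Cu : C * expR (k * ln (u n) - u n) @[n --> \oo] --> (0 : R).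
  by rewrite -[X in _ --> X](mulr0 C); apply: cvgM => //; exact: cvg_cst.
have CuN : - (C * expR (k * ln (u n) - u n)) @[n --> \oo] --> (0 : R).
  by rewrite -oppr0; exact: cvgN.
apply: (squeeze_cvgr _ CuN Cu); apply: nearW => n.
by rewrite -ler_norml; exact: parts_primitive_le.
Qed.

(** By [mul_ln_sub_le] at exponent [k + 1], x times x^k exp(-x) is bounded, so the sequence is
    O(1/n). The offset [a] is 0 on the half-line and [s] beyond the jump. *)
Lemma expR_gamma_cvg_infty (a : R) : 0 <= a ->
  expR (k * ln (a + n.+2%:R) - (a + n.+2%:R)) @[n --> \oo] --> (0 : R).
Proof.
move=> a0; pose C := expR ((k + 1) * ln (k + 1)).
have Ch : C * harmonic n @[n --> \oo] --> (0 : R).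
  by rewrite -[X in _ --> X](mulr0 C); apply: cvgM; [exact: cvg_cst|exact: cvg_harmonic].
apply: (squeeze_cvgr _ (cvg_cst (0 : R)) Ch); apply: nearW => n.
rewrite expR_ge0 /=; set x := a + _.
have x0 : 0 < x by rewrite ltr_wpDl.
have nx : n.+1%:R <= x by rewrite /x ler_wpDl // ler_nat.
have := mul_ln_sub_le (addr_gt0 k0 (@ltr01 R)) x0.
rewrite -ler_expR -/C mulrDl mul1r addrAC expRD lnK ?posrE // -ler_pdivlMr // => /le_trans; apply.
by rewrite ler_wpM2l ?expR_ge0 // lef_pV2 ?posrE.
Qed.

(** The points exp(-n/k) are chosen so that their [k]-th power is exp(-n). *)
Lemma expR_gamma_cvg_0 :
  expR (k * ln (expR (- (n%:R / k))) - expR (- (n%:R / k))) @[n --> \oo] --> (0 : R).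
Proof.
apply: (squeeze_cvgr _ (cvg_cst (0 : R)) (@cvgn_expR R)); apply: nearW => n.
rewrite expR_ge0 /= ler_expR expRK mulrN mulrC divfK ?gt_eqF //.
by rewrite gerBl expR_ge0.
Qed.

Lemma parts_density_integral p q :
  \int[mu]_(x in @halfline R) parts_density p q x = 0.
Proof.
rewrite -(subrr (0 : R)).
apply: (@improper_FTC _ (parts_primitive p q) _ _ (fun n => expR (- (n%:R / k)))
  (fun n => 0 + n.+2%:R)).
- exact: measurable_halfline.
- by move=> x; exact: is_derive_parts_primitive.
- by move=> x; exact: continuous_parts_density.
- exact: integrable_parts_density.
- move=> n; rewrite expR_gt0 /= add0r (@le_lt_trans _ _ 1) ?ltr1n //.
  by rewrite expR_le1 oppr_le0 divr_ge0 // ltW.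
- move=> n x; rewrite /= in_itv /= halflineE => /andP[+ _].
  by apply: lt_le_trans; exact: expR_gt0.
- move=> x; rewrite halflineE => x0.
  near=> n; apply/andP; split.
    rewrite -[leRHS]lnK ?posrE // ler_expR lerNl ler_pdivlMr //.
    by near: n; exact: nbhs_infty_ger.
  rewrite add0r (@le_trans _ _ n%:R) ?ler_nat //; last by rewrite !leqW.
  by near: n; exact: nbhs_infty_ger.
- by apply: parts_primitive_cvg; [move=> n; exact: expR_gt0|exact: expR_gamma_cvg_0].
- by apply: parts_primitive_cvg; [move=> n; rewrite add0r|exact: expR_gamma_cvg_infty].
Unshelve. all: by end_near. Qed.

(** Only the endpoint [s] contributes, by continuity of the primitive there; at infinity it tends to
    0. The domain is open at [s], so the lower endpoints approach from the right. *)
Lemma parts_density_integral_gt p q (s : R) : 0 < s ->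
  \int[mu]_(x in @halfline R) (parts_density p q x * (s < x)%R%:R) = - parts_primitive p q s.
Proof.
move=> s0; rewrite -[RHS]sub0r.
have -> : \int[mu]_(x in @halfline R) (parts_density p q x * (s < x)%R%:R) =
    \int[mu]_(x in `]s, +oo[) parts_density p q x.
  have -> : (`]s, +oo[%classic : set R) = @halfline R `&` `]s, +oo[%classic.
    apply/seteqP; split=> x; rewrite /= !in_itv /= andbT; last by case.
    by rewrite halflineE => sx; split=> //; exact: lt_trans sx.
  rewrite Rintegral_mkcondr; apply: eq_Rintegral => x _; rewrite patchE mem_setE in_itv /= andbT.
  by case: ifP => _; rewrite ?mulr1 ?mulr0.
apply: (@improper_FTC _ (parts_primitive p q) _ _ (fun n => s + n.+1%:R^-1)
  (fun n => s + n.+2%:R)).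
- exact: measurable_itv.
- by move=> x; exact: is_derive_parts_primitive.
- by move=> x; exact: continuous_parts_density.
- apply: (integrableS (@measurable_halfline R) _ _ (integrable_parts_density p q)).
    exact: measurable_itv.
  by move=> x; rewrite /= in_itv /= halflineE andbT; exact: lt_trans.
- move=> n; rewrite addr_gt0 //= ltrD2l (@le_lt_trans _ _ 1) ?ltr1n //.
  by rewrite invf_le1 ?ler1n.
- move=> n x; rewrite /= !in_itv /= andbT => /andP[+ _].
  by apply: lt_le_trans; rewrite ltrDl.
- move=> x; rewrite /= in_itv /= andbT => sx.
  have d0 : 0 < x - s by rewrite subr_gt0.
  near=> n; apply/andP; split.
    rewrite -lerBrDl ltW //; near: n.
    exact: (near_infty_natSinv_lt (PosNum d0)).
  rewrite -lerBlDl (@le_trans _ _ n%:R) ?ler_nat //; last by rewrite !leqW.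
  by near: n; exact: nbhs_infty_ger.
- have cF := derive_continuous (is_derive_parts_primitive p q s0).
  apply: (@continuous_cvg _ _ _ \oo _ (fun n => s + n.+1%:R^-1) (parts_primitive p q) s cF).
  by rewrite -[X in _ --> X]addr0; apply: cvgD; [exact: cvg_cst|exact: cvg_harmonic].
- apply: parts_primitive_cvg; first by move=> n; rewrite addr_gt0.
  by apply: expR_gamma_cvg_infty; exact: ltW.
Unshelve. all: by end_near. Qed.

End RealParts.

(** * The weights *)

Section Weight.
Variable R : realType.
Local Notation mu := (@lebesgue_measure R).
Local Notation H := (@halfline R).
Implicit Types (c xi : R[i]) (s x y : R).

Let mH := @measurable_halfline R.

Lemma weightE c xi s x : 0 < x -> weight c xi s x =
  (1 - xi * (s < x)%R%:R) *
  ((gammad (complex.Re c + 1) x * wave (complex.Im c) 1 0 x) +i*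
   (gammad (complex.Re c + 1) x * wave (complex.Im c) 0 1 x)).
Proof.
move=> x0; rewrite /weight -mulrA; congr (_ * _).
rewrite gammadS // /gammad expRD /cpower /wave.
have xn : x != 0 by rewrite gt_eqF.
by apply/eqP; rewrite eq_complex /=; apply/andP; split; apply/eqP; field.
Qed.

Lemma cpowerD1 c x : 0 < x -> cpower x (c + 1) = cpower x c * x%:C.
Proof.
move=> x0; rewrite /cpower; case: c => a b /=; rewrite addr0 mulrDl mul1r expRD lnK ?posrE //.
by rewrite rmorphM /= -!mulrA; congr (_ * _); rewrite mulrC.
Qed.

Lemma cpowerDn c n x : 0 < x -> cpower x (c + n%:R) = cpower x c * x%:C ^+ n.
Proof.
move=> x0; elim: n => [|n IHn]; first by rewrite addr0 mulr1.
by rewrite -natr1 addrA cpowerD1 // IHn exprSr mulrA.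
Qed.

(** Absorbing the monomial in the exponent makes every moment a plain integral of a weight of the
    same family, so integration by parts is needed only for the weight itself. *)
Lemma weightDn c xi s n x : 0 < x ->
  weight (c + n%:R) xi s x = weight c xi s x * x%:C ^+ n.
Proof. by move=> x0; rewrite /weight cpowerDn // !mulrA mulrAC. Qed.

Lemma measurable_ltr_indic s : measurable_fun H (fun x => (s < x)%R%:R : R).
Proof.
have -> : (fun x => (s < x)%R%:R : R) = \1_(`]s, +oo[%classic).
  by apply/funext => x; rewrite indicE mem_setE in_itv /= andbT.
by apply: measurable_indic; exact: measurable_itv.
Qed.

Lemma Re_natrD c n : complex.Re (c + n%:R) = complex.Re c + n%:R.
Proof. by rewrite raddfD /=; congr (_ + _); rewrite raddfMn. Qed.

Lemma cintegrable_gammad c : -1 < complex.Re c -> cintegrable mu H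
  (fun x => (gammad (complex.Re c + 1) x * wave (complex.Im c) 1 0 x) +i*
     (gammad (complex.Re c + 1) x * wave (complex.Im c) 0 1 x)).
Proof.
move=> c1; have k0 : 0 < complex.Re c + 1 by lra.
have w p q : measurable_fun H (wave (complex.Im c) p q).
  exact: (measurable_fun_halfline (@continuous_wave _ _ p q)).
have I p q := integrable_gammadM k0 (w p q) (fun x _ => wave_le (complex.Im c) p q x).
by split; [exact: (I 1 0)|exact: (I 0 1)].
Qed.

Lemma boolC (b : bool) : (b%:R : R)%:C = b%:R :> R[i].
Proof. by case: b. Qed.

Lemma cintegrable_tail s (f : R -> R[i]) : cintegrable mu H f ->
  cintegrable mu H (fun x => f x * ((s < x)%R%:R)%:C).
Proof.
move=> fi; apply: (@cintegrableMr _ _ R mu H mH f _ 1 _ _ fi).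
  exact: measurable_ltr_indic.
by move=> x _; case: (s < x); rewrite ?normr1 ?normr0.
Qed.

Lemma cintegrable_cut xi s (f : R -> R[i]) : cintegrable mu H f ->
  cintegrable mu H (fun x => (1 - xi * (s < x)%R%:R) * f x).
Proof.
move=> fi.
have fs := cintegrableZ mH (- xi) (cintegrable_tail s fi).
apply: (eq_cintegrable mH _ (cintegrableD mH fi fs)) => x _.
by rewrite boolC; ring.
Qed.

Lemma cintegrable_weight c xi s : -1 < complex.Re c -> cintegrable mu H (weight c xi s).
Proof.
move=> c1; apply: (eq_cintegrable mH _ (cintegrable_cut xi s (cintegrable_gammad c1))).
by move=> x /set_mem; rewrite halflineE => x0; rewrite weightE.
Qed.

Lemma cintegral_cut xi s (f : R -> R[i]) : cintegrable mu H f ->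
  cintegral mu H (fun x => (1 - xi * (s < x)%R%:R) * f x) =
  cintegral mu H f - xi * cintegral mu H (fun x => f x * ((s < x)%R%:R)%:C).
Proof.
move=> fi.
have fs := cintegrable_tail s fi.
rewrite -mulNr -(cintegralZ mH _ fs).
rewrite -(cintegralD mH) //; last first.
  exact: (cintegrableZ mH).
by apply: eq_cintegral => x _; rewrite boolC; ring.
Qed.

(* The integrand is the derivative of [x * weight c xi s x / (x + y)] away from
   the jump at [s]. *)
Lemma weight_by_parts c xi s y : -1 < complex.Re c -> 0 < s -> 0 < y ->
  cintegral mu H (fun x => weight c xi s x *
    ((c + 1 - x%:C - (x / (x + y))%:C) * ((x + y)^-1)%:C)) =
  xi * cpower s (c + 1) * (expR (- s))%:C * ((s + y)^-1)%:C.
Proof.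
move=> c1 s0 y0; have k0 : 0 < complex.Re c + 1 by lra.
set k := complex.Re c + 1 in k0 *; pose b := complex.Im c.
pose G p q := parts_density k b y p q.
have iG : cintegrable mu H (fun x => G 1 0 x +i* G 0 1 x).
  by split; exact: integrable_parts_density.
transitivity (cintegral mu H (fun x => (1 - xi * (s < x)%R%:R) * (G 1 0 x +i* G 0 1 x))).
  apply: eq_cintegral => x /set_mem; rewrite halflineE => x0.
  rewrite weightE // -mulrA; congr (_ * _).
  rewrite -/k -/b /G /parts_density; case: {+}c @k @b {k0 iG G c1} => a b /=.
  by apply/eqP; rewrite eq_complex /wave /=; apply/andP; split; apply/eqP; ring.
(* The uncut integral vanishes and the part beyond [s] gives minus the primitive at [s], so the cut
   leaves [xi] times that value. *)
rewrite cintegral_cut //.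
have -> : cintegral mu H (fun x => G 1 0 x +i* G 0 1 x) = 0.
  by rewrite /cintegral /= !parts_density_integral.
have -> : cintegral mu H (fun x => (G 1 0 x +i* G 0 1 x) * ((s < x)%R%:R)%:C) =
    - (parts_primitive k b y 1 0 s +i* parts_primitive k b y 0 1 s).
  apply/eqP; rewrite eq_complex /=; apply/andP; split; apply/eqP;
    rewrite -parts_density_integral_gt //; apply: eq_Rintegral => x _ /=; rewrite /G; ring.
rewrite sub0r mulrN opprK -!mulrA; congr (_ * _).
rewrite /cpower /parts_primitive expRD /k /b /wave; case: {+}c => u v.
by apply/eqP; rewrite eq_complex /= addr0; apply/andP; split; apply/eqP; ring.
Qed.

End Weight.

(** * The bimoments *)

Section MomentIdentities.
Variable R : realType.
Local Notation mu := (@lebesgue_measure R).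
Local Notation H := (@halfline R).
Implicit Types (c xi : R[i]) (s x y : R).

Let mH := @measurable_halfline R.

Lemma cintegrable_weight_monomial c xi s n : -1 < complex.Re c ->
  cintegrable mu H (fun x => weight c xi s x * x%:C ^+ n).
Proof.
move=> c1; have cn : -1 < complex.Re (c + n%:R).
  by rewrite Re_natrD (lt_le_trans c1) // lerDl.
apply: (eq_cintegrable mH _ (cintegrable_weight xi s cn)) => x /set_mem.
by rewrite halflineE => x0; rewrite weightDn.
Qed.

Lemma measurable_inv_shift y : 0 < y -> measurable_fun H (fun x => (x + y)^-1).
Proof.
move=> y0; apply: measurable_fun_halfline => x x0.
apply: cvgV; first by rewrite gt_eqF // addr_gt0.
by apply: cvgD; [exact: cvg_id|exact: cvg_cst].
Qed.

Lemma cintegrable_weight_div c xi s n y : -1 < complex.Re c -> 0 < y ->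
  cintegrable mu H (fun x => weight c xi s x * x%:C ^+ n * ((x + y)^-1)%:C).
Proof.
move=> c1 y0; have wn := cintegrable_weight_monomial xi s n c1.
apply: (@cintegrableMr _ _ R mu H mH _ _ y^-1 _ _ wn).
  exact: measurable_inv_shift.
move=> x; rewrite halflineE => x0.
by rewrite gtr0_norm ?invr_gt0 ?addr_gt0 // lef_pV2 ?posrE ?addr_gt0 // lerDr ltW.
Qed.

Lemma measurable_frac y : 0 < y -> measurable_fun H (fun x => x / (x + y)).
Proof.
move=> y0; apply: measurable_fun_halfline => x x0.
apply: cvgM; first exact: cvg_id.
apply: cvgV; first by rewrite gt_eqF // addr_gt0.
by apply: cvgD; [exact: cvg_id|exact: cvg_cst].
Qed.

Lemma frac_le1 x y : 0 < x -> 0 < y -> `|x / (x + y)| <= 1.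
Proof.
move=> x0 y0; have xy : 0 < x + y by rewrite addr_gt0.
by rewrite gtr0_norm ?divr_gt0 // ler_pdivrMr // mul1r lerDl ltW.
Qed.

Lemma weight_monomial_by_parts c xi s y n : -1 < complex.Re c -> 0 < s -> 0 < y ->
  cintegrable mu H (fun x => weight c xi s x * x%:C ^+ n *
    ((c + n%:R + 1 - x%:C - (x / (x + y))%:C) * ((x + y)^-1)%:C)) /\
  cintegral mu H (fun x => weight c xi s x * x%:C ^+ n *
    ((c + n%:R + 1 - x%:C - (x / (x + y))%:C) * ((x + y)^-1)%:C)) =
  xi * cpower s (c + 1) * (expR (- s))%:C * s%:C ^+ n * ((s + y)^-1)%:C.
Proof.
move=> c1 s0 y0; split.
  have i0 := cintegrable_weight_div xi s n c1 y0.
  have i1 := cintegrable_weight_div xi s n.+1 c1 y0.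
  have i2 : cintegrable mu H (fun x =>
      weight c xi s x * x%:C ^+ n * ((x + y)^-1)%:C * (x / (x + y))%:C).
    apply: (@cintegrableMr _ _ R mu H mH _ _ 1 _ _ i0); first exact: measurable_frac.
    by move=> x; rewrite halflineE => x0; exact: frac_le1.
  have iz := cintegrableD mH (cintegrableZ mH (c + n%:R + 1) i0)
    (cintegrableD mH (cintegrableZ mH (- 1) i1) (cintegrableZ mH (- 1) i2)).
  by apply: (eq_cintegrable mH _ iz) => x _; rewrite exprSr; ring.
have cn : -1 < complex.Re (c + n%:R) by rewrite Re_natrD (lt_le_trans c1) // lerDl.
have := weight_by_parts xi cn s0 y0.
rewrite addrAC cpowerDn // mulrA [_ * _ ^+ n * _]mulrAC => <-.
apply: eq_cintegral => x /set_mem; rewrite halflineE => x0.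
by rewrite weightDn // (addrAC c).
Qed.

End MomentIdentities.

Section BimomentIdentities.
Variables (R : realType) (a b xi psi : R[i]) (s t : R).
Local Notation mu := (@lebesgue_measure R).
Local Notation H := (@halfline R).
Local Notation mu2 := (lebesgue_measure \x lebesgue_measure)%E.
Local Notation w1 := (weight a xi s).
Local Notation w2 := (weight b psi t).
Hypotheses (a1 : -1 < complex.Re a) (b1 : -1 < complex.Re b) (s0 : 0 < s) (t0 : 0 < t).
Hypothesis conv : forall j k : nat,
  bracket_converges w1 w2 (fun x => x%:C ^+ j) (fun y => y%:C ^+ k).

Let mH := @measurable_halfline R.
Let B j k := bracket_integrand w1 w2 (fun x => x%:C ^+ j) (fun y => y%:C ^+ k).
Let M j k := bimoment w1 w2 j k.

Let mHH := measurableX mH mH.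

Let inHH (z : R * R) : z \in H `*` H -> 0 < z.1 /\ 0 < z.2.
Proof. by move=> /set_mem []; rewrite !halflineE. Qed.

Let addC0 (x y : R) : 0 < x -> 0 < y -> x%:C + y%:C != 0 :> R[i].
Proof.
move=> x0 y0; rewrite -rmorphD /= -[0]/(0%:C) (inj_eq (@complexI R)).
by rewrite gt_eqF // addr_gt0.
Qed.

Lemma bimoment_rank1 j k :
  bimoment w1 w2 j.+1 k + bimoment w1 w2 j k.+1 =
  cintegral mu H (fun x => w1 x * x%:C ^+ j) *
  cintegral mu H (fun y => w2 y * y%:C ^+ k).
Proof.
rewrite /bimoment /bracket -(cintegralD mHH (conv j.+1 k) (conv j k.+1)).
have iw1 := cintegrable_weight_monomial xi s j a1.
have iw2 := cintegrable_weight_monomial psi t k b1.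
have fE : {in H `*` H, forall z : R * R, B j.+1 k z + B j k.+1 z =
    (w2 z.2 * z.2%:C ^+ k) * (w1 z.1 * z.1%:C ^+ j)}.
  move=> z /inHH[z1 z2]; rewrite /B /bracket_integrand rmorphD /= !exprSr.
  by field; exact: addC0.
transitivity (cintegral mu2 (H `*` H)
    (fun z => (w2 z.2 * z.2%:C ^+ k) * (w1 z.1 * z.1%:C ^+ j))).
  by apply: eq_cintegral => z; exact: fE.
rewrite (@cintegral_rectangle21 _ _ _ _ R mu mu H H mH mH _
  (fun y => cintegral mu H (fun x => w1 x * x%:C ^+ j) * (w2 y * y%:C ^+ k))).
- by rewrite (cintegralZ mH _ iw2).
- exact: (eq_cintegrable mHH fE (cintegrableD mHH (conv j.+1 k) (conv j k.+1))).
- by move=> y _ /=; exact: (cintegrableZ mH _ iw1).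
- by move=> y _ /=; rewrite (cintegralZ mH _ iw1) mulrC.
Qed.

(** x d/dx of 1 / (x + y) is the kernel times minus this fraction; [frac2] plays the same part for
    y. *)
Let frac1 (z : R * R) := z.1 / (z.1 + z.2).
Let frac2 (z : R * R) := z.2 / (z.1 + z.2).

Let measurable_inv_sum : measurable_fun (H `*` H) (fun z : R * R => (z.1 + z.2)^-1).
Proof.
apply: (@measurable_comp _ _ _ _ _ _ H (fun x : R => x^-1) _ (fun z : R * R => z.1 + z.2)).
- exact: mH.
- by move=> _ [z [z1 z2] <-]; move: z1 z2; rewrite !halflineE; exact: addr_gt0.
- apply: measurable_fun_halfline => x x0; apply: cvgV; [by rewrite gt_eqF|exact: cvg_id].
- by apply: measurable_funD; apply: measurable_funTS; [exact: measurable_fst|exact: measurable_snd].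
Qed.

Let measurable_frac1 : measurable_fun (H `*` H) frac1.
Proof.
apply: measurable_funM; last exact: measurable_inv_sum.
by apply: measurable_funTS; exact: measurable_fst.
Qed.

Let measurable_frac2 : measurable_fun (H `*` H) frac2.
Proof.
apply: measurable_funM; last exact: measurable_inv_sum.
by apply: measurable_funTS; exact: measurable_snd.
Qed.

Let N1 j k : cintegrable mu2 (H `*` H) (fun z => B j k z * (frac1 z)%:C).
Proof.
apply: (@cintegrableMr _ _ R mu2 _ mHH _ _ 1 _ _ (conv j k)).
  exact: measurable_frac1.
by move=> z [z1 z2]; apply: frac_le1; rewrite -halflineE.
Qed.

Let N2 j k : cintegrable mu2 (H `*` H) (fun z => B j k z * (frac2 z)%:C).
Proof.
apply: (@cintegrableMr _ _ R mu2 _ mHH _ _ 1 _ _ (conv j k)).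
  exact: measurable_frac2.
by move=> z [z1 z2]; rewrite /frac2 addrC; apply: frac_le1; rewrite -halflineE.
Qed.

Let fracD j k : cintegral mu2 (H `*` H) (fun z => B j k z * (frac1 z)%:C) +
  cintegral mu2 (H `*` H) (fun z => B j k z * (frac2 z)%:C) = M j k.
Proof.
rewrite -(cintegralD mHH (N1 j k) (N2 j k)); apply: eq_cintegral => z /inHH[z1 z2].
rewrite -mulrDr -rmorphD /= /frac1 /frac2 -mulrDl divff ?mulr1 //.
by rewrite gt_eqF // addr_gt0.
Qed.

(** For fixed y the inner integral is that of a derivative, and only the jump at [s] survives; the
    outer integral of the kernel value 1 / (s + y) is, up to sign, a Cauchy transform of [w2] at
    [- s]. *)
Let parts1 j k : (a + j%:R + 1) * M j k - M j.+1 k -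
  cintegral mu2 (H `*` H) (fun z => B j k z * (frac1 z)%:C) =
  xi * cpower s (a + 1) * (expR (- s))%:C * s%:C ^+ j *
  cintegral mu H (fun y => w2 y * y%:C ^+ k * ((y + s)^-1)%:C).
Proof.
have iz := cintegrableD mHH (cintegrableZ mHH (a + j%:R + 1) (conv j k))
  (cintegrableD mHH (cintegrableZ mHH (- 1) (conv j.+1 k)) (cintegrableZ mHH (- 1) (N1 j k))).
transitivity (cintegral mu2 (H `*` H) (fun z => (a + j%:R + 1) * B j k z +
    (- 1 * B j.+1 k z + - 1 * (B j k z * (frac1 z)%:C)))).
  rewrite (cintegralD mHH (cintegrableZ mHH _ (conv j k))
    (cintegrableD mHH (cintegrableZ mHH _ (conv j.+1 k)) (cintegrableZ mHH _ (N1 j k)))).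
  rewrite (cintegralD mHH (cintegrableZ mHH _ (conv j.+1 k)) (cintegrableZ mHH _ (N1 j k))).
  rewrite (cintegralZ mHH _ (conv j k)) (cintegralZ mHH _ (conv j.+1 k)).
  by rewrite (cintegralZ mHH _ (N1 j k)) !mulN1r addrA.
have fE : {in H `*` H, forall z : R * R, (a + j%:R + 1) * B j k z +
    (- 1 * B j.+1 k z + - 1 * (B j k z * (frac1 z)%:C)) =
    (w2 z.2 * z.2%:C ^+ k) * (w1 z.1 * z.1%:C ^+ j *
    ((a + j%:R + 1 - z.1%:C - (z.1 / (z.1 + z.2))%:C) * ((z.1 + z.2)^-1)%:C))}.
  by move=> z /inHH[z1 z2]; rewrite /B /bracket_integrand /frac1 fmorphV exprSr; ring.
have iw2 := cintegrable_weight_div psi t k b1 s0.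
transitivity (cintegral mu2 (H `*` H) (fun z => (w2 z.2 * z.2%:C ^+ k) *
    (w1 z.1 * z.1%:C ^+ j * ((a + j%:R + 1 - z.1%:C - (z.1 / (z.1 + z.2))%:C) *
    ((z.1 + z.2)^-1)%:C)))).
  by apply: eq_cintegral => z; exact: fE.
rewrite (@cintegral_rectangle21 _ _ _ _ R mu mu H H mH mH _
  (fun y => xi * cpower s (a + 1) * (expR (- s))%:C * s%:C ^+ j *
     (w2 y * y%:C ^+ k * ((y + s)^-1)%:C))).
- by rewrite (cintegralZ mH _ iw2).
- exact: (eq_cintegrable mHH fE iz).
- move=> y; rewrite halflineE => y0; have [iy _] := weight_monomial_by_parts xi j a1 s0 y0.
  exact: (cintegrableZ mH (w2 y * y%:C ^+ k) iy).
- move=> y; rewrite halflineE => y0; have [iy yE] := weight_monomial_by_parts xi j a1 s0 y0.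
  by rewrite (cintegralZ mH (w2 y * y%:C ^+ k) iy) yE (addrC s); ring.
Qed.

Let parts2 j k : (b + k%:R + 1) * M j k - M j k.+1 -
  cintegral mu2 (H `*` H) (fun z => B j k z * (frac2 z)%:C) =
  psi * cpower t (b + 1) * (expR (- t))%:C * t%:C ^+ k *
  cintegral mu H (fun x => w1 x * x%:C ^+ j * ((x + t)^-1)%:C).
Proof.
have iz := cintegrableD mHH (cintegrableZ mHH (b + k%:R + 1) (conv j k))
  (cintegrableD mHH (cintegrableZ mHH (- 1) (conv j k.+1)) (cintegrableZ mHH (- 1) (N2 j k))).
transitivity (cintegral mu2 (H `*` H) (fun z => (b + k%:R + 1) * B j k z +
    (- 1 * B j k.+1 z + - 1 * (B j k z * (frac2 z)%:C)))).
  rewrite (cintegralD mHH (cintegrableZ mHH _ (conv j k))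
    (cintegrableD mHH (cintegrableZ mHH _ (conv j k.+1)) (cintegrableZ mHH _ (N2 j k)))).
  rewrite (cintegralD mHH (cintegrableZ mHH _ (conv j k.+1)) (cintegrableZ mHH _ (N2 j k))).
  rewrite (cintegralZ mHH _ (conv j k)) (cintegralZ mHH _ (conv j k.+1)).
  by rewrite (cintegralZ mHH _ (N2 j k)) !mulN1r addrA.
have fE : {in H `*` H, forall z : R * R, (b + k%:R + 1) * B j k z +
    (- 1 * B j k.+1 z + - 1 * (B j k z * (frac2 z)%:C)) =
    (w1 z.1 * z.1%:C ^+ j) * (w2 z.2 * z.2%:C ^+ k *
    ((b + k%:R + 1 - z.2%:C - (z.2 / (z.2 + z.1))%:C) * ((z.2 + z.1)^-1)%:C))}.
  move=> z /inHH[z1 z2]; rewrite /B /bracket_integrand /frac2 fmorphV exprSr (addrC z.2).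
  by ring.
have iw1 := cintegrable_weight_div xi s j a1 t0.
transitivity (cintegral mu2 (H `*` H) (fun z => (w1 z.1 * z.1%:C ^+ j) *
    (w2 z.2 * z.2%:C ^+ k * ((b + k%:R + 1 - z.2%:C - (z.2 / (z.2 + z.1))%:C) *
    ((z.2 + z.1)^-1)%:C)))).
  by apply: eq_cintegral => z; exact: fE.
rewrite (@cintegral_rectangle12 _ _ _ _ R mu mu H H mH mH _
  (fun x => psi * cpower t (b + 1) * (expR (- t))%:C * t%:C ^+ k *
     (w1 x * x%:C ^+ j * ((x + t)^-1)%:C))).
- by rewrite (cintegralZ mH _ iw1).
- exact: (eq_cintegrable mHH fE iz).
- move=> x; rewrite halflineE => x0; have [ix _] := weight_monomial_by_parts psi k b1 t0 x0.
  exact: (cintegrableZ mH (w1 x * x%:C ^+ j) ix).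
- move=> x; rewrite halflineE => x0; have [ix xE] := weight_monomial_by_parts psi k b1 t0 x0.
  by rewrite (cintegralZ mH (w1 x * x%:C ^+ j) ix) xE (addrC t); ring.
Qed.

(** In the sum of [parts1] and [parts2] the two fraction integrals add up to one bimoment, which
    lowers (a + j + 1) + (b + k + 1) by 1. *)
Lemma bimoment_euler j k :
  (a + b + 1 + j%:R + k%:R) * bimoment w1 w2 j k =
  bimoment w1 w2 j.+1 k + bimoment w1 w2 j k.+1 +
  xi * cpower s (a + 1) * (expR (- s))%:C * s%:C ^+ j *
    cintegral mu H (fun y => w2 y * y%:C ^+ k * ((y + s)^-1)%:C) +
  psi * cpower t (b + 1) * (expR (- t))%:C * t%:C ^+ k *
    cintegral mu H (fun x => w1 x * x%:C ^+ j * ((x + t)^-1)%:C).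
Proof.
rewrite -parts1 -parts2; move: (fracD j k); rewrite /M.
move: (cintegral mu2 (H `*` H) (fun z => B j k z * (frac1 z)%:C)).
move: (cintegral mu2 (H `*` H) (fun z => B j k z * (frac2 z)%:C)) => n2 n1.
move: (bimoment w1 w2 j k) (bimoment w1 w2 j.+1 k) (bimoment w1 w2 j k.+1).
by move=> m m1 m2 <-; ring.
Qed.

End BimomentIdentities.

(** * The bracket on polynomials *)

Lemma poly_linear_ind (F : nzRingType) (K : {poly F} -> Prop) :
  (forall c p q, K p -> K q -> K (c *: p + q)) -> (forall n, K 'X^n) ->
  forall p, K p.
Proof.
move=> Klin KX p; rewrite -[p]coefK poly_def; elim: (size p) => [|n IHn].
  (* The zero polynomial is reached as [-1 *: 'X^0 + 'X^0]. *)
  by rewrite big_ord0 -(addNr ('X^0 : {poly F})) -scaleN1r; exact: Klin.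
by rewrite big_ord_recr /= addrC; exact: Klin.
Qed.

Section PolynomialFunctionals.
Variable R : realType.
Local Notation mu := (@lebesgue_measure R).
Local Notation H := (@halfline R).
Implicit Types (c xi : R[i]) (s t : R) (p q : {poly R[i]}).

Let mH := @measurable_halfline R.

Lemma evalR_lin c p q x : evalR (c *: p + q) x = c * evalR p x + evalR q x.
Proof. by rewrite /evalR hornerD hornerZ. Qed.

Lemma evalRXn n x : evalR ('X^n) x = x%:C ^+ n :> R[i].
Proof. by rewrite /evalR hornerXn. Qed.

Section OneWeight.
Variables (c xi : R[i]) (s : R).
Hypothesis c1 : -1 < complex.Re c.
Local Notation w := (weight c xi s).

Lemma cintegrable_weight_poly p : cintegrable mu H (fun x => w x * evalR p x).
Proof.
elim/poly_linear_ind: p => [k p q ip iq|n].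
  apply: (eq_cintegrable mH _ (cintegrableD mH (cintegrableZ mH k ip) iq)) => x _.
  by rewrite evalR_lin; ring.
apply: (eq_cintegrable mH _ (cintegrable_weight_monomial xi s n c1)) => x _.
by rewrite evalRXn.
Qed.

Lemma weighted_integral_scalar : scalar (weighted_integral w).
Proof.
move=> k p q; have ip := cintegrable_weight_poly p; have iq := cintegrable_weight_poly q.
rewrite /weighted_integral -(cintegralZ mH k ip) -(cintegralD mH (cintegrableZ mH k ip) iq).
by apply: eq_cintegral => x _; rewrite evalR_lin; ring.
Qed.

Lemma weighted_integralXn n :
  weighted_integral w 'X^n = cintegral mu H (fun x => w x * x%:C ^+ n).
Proof. by apply: eq_cintegral => x _; rewrite evalRXn. Qed.

Variables (y : R) (y0 : 0 < y).

Let opp_inv x : (- y%:C - x%:C)^-1 = - ((x + y)^-1)%:C :> R[i].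
Proof. by rewrite -opprD invrN addrC fmorphV rmorphD. Qed.

Lemma cintegrable_cauchy_poly p :
  cintegrable mu H (fun x => w x / (- y%:C - x%:C) * evalR p x).
Proof.
elim/poly_linear_ind: p => [k p q ip iq|n].
  apply: (eq_cintegrable mH _ (cintegrableD mH (cintegrableZ mH k ip) iq)) => x _.
  by rewrite evalR_lin; ring.
apply: (eq_cintegrable mH _ (cintegrableZ mH (-1) (cintegrable_weight_div xi s n c1 y0))) => x _.
by rewrite evalRXn opp_inv; ring.
Qed.

Lemma cauchy_transform_scalar : scalar (fun p => cauchy_transform w p (- y%:C)).
Proof.
move=> k p q; have ip := cintegrable_cauchy_poly p; have iq := cintegrable_cauchy_poly q.
rewrite /cauchy_transform -(cintegralZ mH k ip) -(cintegralD mH (cintegrableZ mH k ip) iq).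
by apply: eq_cintegral => x _; rewrite evalR_lin; ring.
Qed.

(** At z = -y the kernel 1 / (z - x) is -1 / (x + y); hence the jump terms carry plus signs in
    [bimoment_euler] and minus signs in [bracket_euler]. *)
Lemma cauchy_transformXn n : cauchy_transform w 'X^n (- y%:C) =
  - cintegral mu H (fun x => w x * x%:C ^+ n * ((x + y)^-1)%:C).
Proof.
rewrite -[RHS]mulN1r -(cintegralZ mH _ (cintegrable_weight_div xi s n c1 y0)).
by apply: eq_cintegral => x _; rewrite evalRXn opp_inv; ring.
Qed.

(** From x / (z - x) = z / (z - x) - 1 at z = -y. This is the shift rule with [kappa = 1] used by
    the Christoffel-Darboux formula. *)
Lemma cauchy_transformX p : cauchy_transform w ('X * p) (- y%:C) =
  - y%:C * cauchy_transform w p (- y%:C) - weighted_integral w p.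
Proof.
have ip := cintegrable_cauchy_poly p; have jp := cintegrable_weight_poly p.
rewrite /cauchy_transform /weighted_integral -(cintegralZ mH _ ip).
rewrite -[X in _ = _ + X]mulN1r -(cintegralZ mH _ jp).
rewrite -(cintegralD mH (cintegrableZ mH _ ip) (cintegrableZ mH _ jp)).
apply: eq_cintegral => x /set_mem; rewrite halflineE => x0.
rewrite /evalR hornerM hornerX; field.
rewrite -opprD oppr_eq0 -rmorphD /= -[0]/(0%:C) (inj_eq (@complexI R)).
by rewrite gt_eqF // addr_gt0.
Qed.

End OneWeight.

Section TwoWeights.
Variables (a b xi psi : R[i]) (s t : R).
Local Notation w1 := (weight a xi s).
Local Notation w2 := (weight b psi t).
Hypotheses (a1 : -1 < complex.Re a) (b1 : -1 < complex.Re b) (s0 : 0 < s) (t0 : 0 < t).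
Hypothesis conv : forall j k : nat,
  bracket_converges w1 w2 (fun x => x%:C ^+ j) (fun y => y%:C ^+ k).

Let mHH := measurableX mH mH.
Let br p q := bracket w1 w2 (evalR p) (evalR q).
Let mu1 := weighted_integral w1.
Let mu2 := weighted_integral w2.
Let c1 p := cauchy_transform w1 p (- t%:C).
Let c2 p := cauchy_transform w2 p (- s%:C).

Lemma bracket_converges_poly p q : bracket_converges w1 w2 (evalR p) (evalR q).
Proof.
elim/poly_linear_ind: p => [k p p' ip ip'|j].
  apply: (eq_cintegrable mHH _ (cintegrableD mHH (cintegrableZ mHH k ip) ip')) => z _.
  by rewrite /bracket_integrand evalR_lin; ring.
elim/poly_linear_ind: q => [k q q' iq iq'|k].
  apply: (eq_cintegrable mHH _ (cintegrableD mHH (cintegrableZ mHH k iq) iq')) => z _.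
  by rewrite /bracket_integrand evalR_lin; ring.
apply: (eq_cintegrable mHH _ (conv j k)) => z _.
by rewrite /bracket_integrand !evalRXn.
Qed.

Lemma bracket_scalarl q : scalar (fun p => bracket w1 w2 (evalR p) (evalR q)).
Proof.
move=> k p p'; have ip := bracket_converges_poly p q; have ip' := bracket_converges_poly p' q.
rewrite /bracket -(cintegralZ mHH k ip) -(cintegralD mHH (cintegrableZ mHH k ip) ip').
by apply: eq_cintegral => z _; rewrite /bracket_integrand evalR_lin; ring.
Qed.

Lemma bracket_scalarr p : scalar (fun q => bracket w1 w2 (evalR p) (evalR q)).
Proof.
move=> k q q'; have iq := bracket_converges_poly p q; have iq' := bracket_converges_poly p q'.
rewrite /bracket -(cintegralZ mHH k iq) -(cintegralD mHH (cintegrableZ mHH k iq) iq').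
by apply: eq_cintegral => z _; rewrite /bracket_integrand evalR_lin; ring.
Qed.

Lemma bracketXn j k : bracket w1 w2 (evalR 'X^j) (evalR 'X^k) = bimoment w1 w2 j k.
Proof. by apply: eq_cintegral => z _; rewrite /bracket_integrand !evalRXn. Qed.

Let brl k p p' q : br (k *: p + p') q = k * br p q + br p' q.
Proof. exact: bracket_scalarl. Qed.

Let brr k p q q' : br p (k *: q + q') = k * br p q + br p q'.
Proof. exact: bracket_scalarr. Qed.

Let brZl k p q : br (k *: p) q = k * br p q.
Proof. exact: (scalarfZ k p (bracket_scalarl q)). Qed.

Let brZr k p q : br p (k *: q) = k * br p q.
Proof. exact: (scalarfZ k q (bracket_scalarr p)). Qed.

Let mu1l k p q : mu1 (k *: p + q) = k * mu1 p + mu1 q.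
Proof. exact: weighted_integral_scalar. Qed.

Let mu2l k p q : mu2 (k *: p + q) = k * mu2 p + mu2 q.
Proof. exact: weighted_integral_scalar. Qed.

Let c1l k p q : c1 (k *: p + q) = k * c1 p + c1 q.
Proof. exact: cauchy_transform_scalar. Qed.

Let c2l k p q : c2 (k *: p + q) = k * c2 p + c2 q.
Proof. exact: cauchy_transform_scalar. Qed.

Let mulX_lin k p q : 'X * (k *: p + q) = k *: ('X * p) + 'X * q.
Proof. by rewrite mulrDr -scalerAr. Qed.

Lemma bracket_rank1 p q :
  bracket w1 w2 (evalR ('X * p)) (evalR q) + bracket w1 w2 (evalR p) (evalR ('X * q)) =
  weighted_integral w1 p * weighted_integral w2 q.
Proof.
rewrite -!/(br _ _); apply: (scalarf_ext (f := fun p => br ('X * p) q + br p ('X * q))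
  (g := fun p => mu1 p * mu2 q)) p => [k p p'|k p p'|j].
- by rewrite mulX_lin !brl; ring.
- by rewrite mu1l; ring.
apply: (scalarf_ext (f := fun q => br ('X * 'X^j) q + br 'X^j ('X * q))
  (g := fun q => mu1 'X^j * mu2 q)) q => [k p p'|k p p'|k].
- by rewrite mulX_lin !brr; ring.
- by rewrite mu2l; ring.
by rewrite -!exprS /br !bracketXn /mu1 /mu2 !weighted_integralXn bimoment_rank1.
Qed.

(** Both sides are linear in [p] and in [q]. On monomials x d/dx acts as the scalars [j] and [k],
    which complete [a + b + 1] to the factor in [bimoment_euler]. *)
Lemma bracket_euler p q :
  bracket w1 w2 (evalR ('X * p^`())) (evalR q) +
    bracket w1 w2 (evalR p) (evalR ('X * q^`())) +
    (a + b + 1) * bracket w1 w2 (evalR p) (evalR q) =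
  bracket w1 w2 (evalR ('X * p)) (evalR q) + bracket w1 w2 (evalR p) (evalR ('X * q))
  - xi * cpower s (a + 1) * (expR (- s))%:C * p.[s%:C] * cauchy_transform w2 q (- s%:C)
  - psi * cpower t (b + 1) * (expR (- t))%:C * cauchy_transform w1 p (- t%:C) * q.[t%:C].
Proof.
rewrite -!/(br _ _) -!/(c1 _) -!/(c2 _).
set A := xi * _ * _; set B := psi * _ * _.
apply: (scalarf_ext (f := fun p => br ('X * p^`()) q + br p ('X * q^`()) + (a + b + 1) * br p q)
  (g := fun p => br ('X * p) q + br p ('X * q) - A * p.[s%:C] * c2 q - B * c1 p * q.[t%:C])) p
  => [k p p'|k p p'|j].
- by rewrite derivD derivZ mulX_lin !brl; ring.
- rewrite mulX_lin !brl hornerD hornerZ c1l; ring.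
apply: (scalarf_ext
  (f := fun q => br ('X * 'X^j^`()) q + br 'X^j ('X * q^`()) + (a + b + 1) * br 'X^j q)
  (g := fun q => br ('X * 'X^j) q + br 'X^j ('X * q) - A * ('X^j).[s%:C] * c2 q
    - B * c1 'X^j * q.[t%:C])) q => [k p p'|k p p'|k].
- by rewrite derivD derivZ mulX_lin !brr; ring.
- rewrite mulX_lin !brr hornerD hornerZ c2l; ring.
have XD n : 'X * ('X^n)^`() = n%:R *: 'X^n :> {poly R[i]}.
  case: n => [|n]; first by rewrite expr0 derivC mulr0 scale0r.
  by rewrite derivXn -mulr_natl mulrCA -exprS scaler_nat mulr_natl.
rewrite !XD brZl brZr.
rewrite -!exprS /br !bracketXn !hornerXn /c1 /c2 !cauchy_transformXn //.
have := bimoment_euler a1 b1 s0 t0 conv j k; rewrite -/A -/B.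
set I2 := cintegral _ _ _; set I1 := cintegral _ _ _ => E.
transitivity ((a + b + 1 + j%:R + k%:R) * bimoment w1 w2 j k); first by ring.
by rewrite E; ring.
Qed.

End TwoWeights.
End PolynomialFunctionals.

(** * Degrees of the spectral polynomials and conclusion *)

Section Sizes.
Variable F : fieldType.
Implicit Types (p q : {poly F}) (c d : F).

Lemma size_mul_leq p q m n : (size p <= m.+1)%N -> (size q <= n.+1)%N ->
  (size (p * q)%R <= (m + n).+1)%N.
Proof.
move=> pm qn; apply: leq_trans (size_polyMleq _ _) _.
by rewrite -subn1 leq_subLR add1n -addnS -addSn leq_add.
Qed.

Lemma size_add_leq p q n : (size p <= n)%N -> (size q <= n)%N ->
  (size (p + q)%R <= n)%N.
Proof. by move=> pn qn; rewrite (leq_trans (size_polyD _ _)) // geq_max pn. Qed.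

Lemma size_addXC c : size ('X + c%:P) = 2.
Proof. by rewrite -[c]opprK polyCN size_XsubC. Qed.

End Sizes.
Theorem proposition4p7 (R : realType) (a b xi psi : R[i]) (s t : R)
    (S : nat -> R[i]) (P Q : nat -> {poly R[i]})
    (w1 := weight a xi s) (w2 := weight b psi t)
    (pi_ := fun n => weighted_integral w1 (P n))
    (eta_ := fun n => weighted_integral w2 (Q n))
    (X_ := fun n => bracket w1 w2 (evalR ('X * P n)) (evalR (Q n)))
    (Y_ := fun n => bracket w1 w2 (evalR (P n)) (evalR ('X * Q n)))
    (P1 := fun z n => cauchy_transform w1 (P n) z)
    (Q1 := fun z n => cauchy_transform w2 (Q n) z)
    (Qt := fun n => (Q n).[t%:C]) :
  -1 < complex.Re a -> -1 < complex.Re b -> 0 < s -> 0 < t ->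
  (forall j k : nat,
     bracket_converges w1 w2 (fun x => x%:C ^+ j) (fun y => y%:C ^+ k)) ->
  (forall n, bimoment_det w1 w2 n != 0) ->
  cauchy_biorthonormal w1 w2 S P Q ->
  (forall n, pi_ n != 0) -> (forall n, eta_ n != 0) ->
  forall n : nat,
  let xs : {poly R[i]} := 'X - s%:C%:P in
  let xt : {poly R[i]} := 'X + t%:C%:P in
  let r : R[i] := S n / S n.+1 in
  let r' : R[i] := at_pred S n / S n in
  let As : R[i] := xi * cpower s (a + 1) * (expR (- s))%:C / (pi_ n * eta_ n)
              * (P n).[s%:C] in
  let Bt : R[i] := psi * cpower t (b + 1) * (expR (- t))%:C / (pi_ n * eta_ n)
              * P1 (- t%:C) n in
  let Q1s := Q1 (- s%:C) in
  exists ThetaP Omega ThetaM : {poly R[i]},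
  [/\ 'X * xs * xt * (P n)^`() =
        ThetaP * P n.+1 + Omega * P n + ThetaM * at_pred P n,
      size ThetaP = 3%N /\
      (S n.+1 / S n) *: ThetaP =
        - (xs * xt)
        - As *: xt * (r * Q1s n.+1 + (Y_ n + s%:C) * Q1s n
                      - r' * at_pred Q1s n)%:P
        - Bt *: xs * (r * Qt n.+1 + (Y_ n - t%:C) * Qt n
                      - r' * at_pred Qt n)%:P,
      ((0 < n)%N -> size ThetaM = 3%N /\
       (S n / at_pred S n) *: ThetaM =
        xs * xt
        + As *: xt * (r * Q1s n.+1 - (X_ n - s%:C) * Q1s n
                      - r' * at_pred Q1s n)%:P
        + Bt *: xs * (r * Qt n.+1 - (X_ n + t%:C) * Qt n
                      - r' * at_pred Qt n)%:P) &
      size Omega = 4%N /\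
      Omega =
        xs * xt * ('X + (Y_ n - n%:R - a - b - 1)%:P)
        - As *: xt * (((X_ n)%:P - 'X) * (r * Q1s n.+1)%:P
                      + ((Y_ n)%:P + 'X) * ((X_ n - s%:C) * Q1s n)%:P
                      + ((Y_ n)%:P + 'X) * (r' * at_pred Q1s n)%:P)
        - Bt *: xs * (((X_ n)%:P - 'X) * (r * Qt n.+1)%:P
                      + ((Y_ n)%:P + 'X) * ((X_ n + t%:C) * Qt n)%:P
                      + ((Y_ n)%:P + 'X) * (r' * at_pred Qt n)%:P)].

Proof.
move=> a1 b1 s0 t0 conv _ [_ sP sQ PQ] pi0 eta0 n xs xt r r' As Bt Q1s.
have biorth : biorthonormal (fun p q => bracket w1 w2 (evalR p) (evalR q)) S P Q.
  by split.
have S0 := biorth_lead_neq0 biorth.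
(* The constants passed for [A] and [B] are the drops of x w1 at [s] and of y w2 at [t]. *)
have SR := @spectral_relation _ _ (weighted_integral w1) (weighted_integral w2)
  (fun p => cauchy_transform w1 p (- t%:C)) (fun p => cauchy_transform w2 p (- s%:C))
  S P Q (xi * cpower s (a + 1) * (expR (- s))%:C) (psi * cpower t (b + 1) * (expR (- t))%:C)
  s%:C t%:C (a + b + 1) (bracket_scalarl conv) (bracket_scalarr conv) biorth
  (bracket_rank1 a1 b1 conv) (cauchy_transform_scalar psi t b1 s0)
  (cauchy_transformX psi t b1 s0) (bracket_euler a1 b1 s0 t0 conv) n
  (mulf_neq0 (pi0 n) (eta0 n)).
have sxx : size (xs * xt) = 3.
  by rewrite size_mul ?size_XsubC ?size_addXC // -size_poly_eq0 ?size_XsubC ?size_addXC.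
have sxt1 c : (size (c *: xt)%R <= 2)%N.
  by rewrite (leq_trans (size_scale_leq _ _)) ?size_addXC.
have sxs1 c : (size (c *: xs)%R <= 2)%N.
  by rewrite (leq_trans (size_scale_leq _ _)) ?size_XsubC.
have sC (c : R[i]) : (size c%:P <= 1)%N by exact: size_polyC_leq1.
(* Each jump term is a constant times [xt] or [xs], of degree at most 1, so the quadratic term fixes
   the size. *)
have sTheta (p : {poly R[i]}) c d c' d' : size p = 3 ->
    size (p + (c *: xt * d%:P + c' *: xs * d'%:P)) = 3.
  move=> p3; rewrite size_polyDl // p3 ltnS.
  by apply: size_add_leq; apply: (@size_mul_leq _ _ _ 1 0).
eexists; eexists; eexists; split; first exact: SR.
- split.
    rewrite size_scale ?mulf_neq0 ?invr_eq0 // -addrA -!opprD size_polyN.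
    exact: sTheta.
  by rewrite scalerA mulrA divfK // divff // scale1r.
(* At [n = 0] one has [r' = 0] and this polynomial is zero, so its degree is claimed only for
   positive [n]. *)
- move=> n0; have p0 : at_pred S n != 0 by case: {+}n n0 => //= m _.
  split.
    rewrite size_scale ?mulf_neq0 ?invr_eq0 // -addrA.
    by apply: sTheta.
  by rewrite scalerA mulrA divfK // divff // scale1r.
- split; last by rewrite !opprD !addrA.
  (* In [Omega] the jump terms are products of two linear factors, of degree at most 2, below the
     leading cubic. *)
  have s4 c : size (xs * xt * ('X + c%:P)) = 4.
    by rewrite size_mul ?sxx ?size_addXC // -size_poly_eq0 ?sxx ?size_addXC.
  rewrite -addrA size_polyDl s4 // ltnS.
  have sYX (y d : R[i]) : (size ((y%:P + 'X) * d%:P)%R <= 2)%N.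
    by apply: (@size_mul_leq _ _ _ 1 0) => //; rewrite addrC size_addXC.
  have sXX (x d : R[i]) : (size ((x%:P - 'X) * d%:P)%R <= 2)%N.
    by apply: (@size_mul_leq _ _ _ 1 0) => //; rewrite -opprB size_polyN size_XsubC.
  by rewrite -opprD size_polyN; apply: size_add_leq;
    apply: (@size_mul_leq _ _ _ 1 1) => //; apply: size_add_leq => //;
    apply: size_add_leq.
Qed.
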